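(* Let $d\ge1$ and $n\ge2$. The groups $\operatorname{Aut}(dV_n)$ and $d\mathcal{B}_{n,1}$ are isomorphic.
   Context: Functions are written on the right and composed left to right. $X_n=\{0,\dots,n-1\}$, $X_n^*$ is the monoid of finite words (with empty word), $\mathfrak{C}_n=X_n^\omega$ is Cantor space, $H(\mathfrak{C}_n^d)$ is the homeomorphism group of $\mathfrak{C}_n^d$, $\boldsymbol{\pi}_i$ is the $i$-th coordinate projection. For $w\in(X_n^* )^d$ the cone $w\mathfrak{C}_n^d$ is the set of $x\in\mathfrak{C}_n^d$ having $w$ as a prefix in every coordinate. If $a$ is a (coordinatewise) prefix of $b$ then $b-a$ is the unique $z$ with $az=b$ (coordinatewise concatenation). A complete prefix code is a finite $F\subseteq(X_n^* )^d$ whose cones partition $\mathfrak{C}_n^d$. The group $dV_n$ consists of all homeomorphisms $f_\phi$ of $\mathfrak{C}_n^d$, where $\phi:F_1\to F_2$ is a bijection between complete prefix codes and $(x)f_\phi=(w\phi)(x-w)$ for $x\in w\mathfrak{C}_n^d$, $w\in F_1$. A $(d,n)$-transducer $T$ consists of a state set $Q_T$, a right monoid action $\pi_T:Q_T\times(X_n^* )^d\to Q_T$, and an output function $\lambda_T:Q_T\times(X_n^* )^d\to(X_n^* )^d$ with $(q,st)\lambda_T=(q,s)\lambda_T\cdot((q,s)\pi_T,t)\lambda_T$. For $h\in H(\mathfrak{C}_n^d)$, $T_h$ is the $(d,n)$-transducer with states $(X_n^* )^d$, transitions $(s,t)\pi_{T_h}=st$, and output given in coordinate $i$ by $(s,t)\lambda_{T_h}\boldsymbol{\pi}_i=b-a$,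 where $b$ and $a$ are the longest common prefixes of the words in $((st\mathfrak{C}_n^d)h)\boldsymbol{\pi}_i$ and $((s\mathfrak{C}_n^d)h)\boldsymbol{\pi}_i$ respectively. $M_h$ is the quotient transducer of $T_h$ obtained by identifying states $p,q$ whenever $(p,s)\lambda_{T_h}=(q,s)\lambda_{T_h}$ for all $s$. A $(d,n)$-transducer $T$ is synchronizing if there is $k\in\mathbb{N}$ such that $(p,w)\pi_T=(q,w)\pi_T$ for all states $p,q$ and all $w\in(X_n^* )^d$ all of whose coordinates have length at least $k$. $d\mathcal{S}_{n,1}$ is the set of $f\in H(\mathfrak{C}_n^d)$ such that $M_f$ is synchronizing; it is a monoid under composition. $d\mathcal{B}_{n,1}$ is its group of units. *)

(* Defs.v *)
From HB Require Import structures.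
From mathcomp Require Import all_boot all_order generic_quotient.
From mathcomp Require Import all_classical topology function_spaces.

Set Implicit Arguments.
Unset Strict Implicit.
Unset Printing Implicit Defensive.

Import Algebra.
Local Open Scope classical_set_scope.
Local Open Scope group_scope.
Local Open Scope quotient_scope.

(* Functions act on the right and compose from left to right: in all the      *)
(* groups and monoids of maps below, f * g is "f, then g".                    *)

Section Homeomorphisms.
Variable T : topologicalType.

Record homeo := Homeo {
  homeo_fun :> T -> T;
  homeo_inv : T -> T;
  homeoK : cancel homeo_fun homeo_inv;
  homeo_invK : cancel homeo_inv homeo_fun;
  homeo_continuous : continuous homeo_fun;
  homeo_inv_continuous : continuous homeo_inv }.

HB.instance Definition _ := gen_eqMixin homeo.
HB.instance Definition _ := gen_choiceMixin homeo.

Lemma homeoP (f g : homeo) : f =1 g -> f = g.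
Proof.
case: f g => [f f' fK f'K fc f'c] [g g' gK g'K gc g'c] /= /funext eqfg.
subst g; have eqf' : f' = g'.
  by apply: funext => y; rewrite -{1}(g'K y) fK.
by subst g'; congr Homeo; exact: Prop_irrelevance.
Qed.

Definition homeo_one : homeo :=
  @Homeo id id (fun=> erefl) (fun=> erefl)
    (fun=> @cvg_id _ _) (fun=> @cvg_id _ _).

Definition homeo_mul (f g : homeo) : homeo :=
  @Homeo (g \o f) (homeo_inv f \o homeo_inv g)
    (can_comp (@homeoK g) (@homeoK f))
    (can_comp (@homeo_invK f) (@homeo_invK g))
    (fun x => continuous_comp (@homeo_continuous f x) (@homeo_continuous g (f x)))
    (fun x => continuous_comp (@homeo_inv_continuous g x)
                (@homeo_inv_continuous f (homeo_inv g x))).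

Definition homeo_opp (f : homeo) : homeo :=
  @Homeo (homeo_inv f) f (@homeo_invK f) (@homeoK f)
    (@homeo_inv_continuous f) (@homeo_continuous f).

Fact homeo_mulA : associative homeo_mul. Proof. by move=> f g h; apply: homeoP. Qed.
Fact homeo_mul1 : left_id homeo_one homeo_mul. Proof. by move=> f; apply: homeoP. Qed.
Fact homeo_mulr1 : right_id homeo_one homeo_mul. Proof. by move=> f; apply: homeoP. Qed.
Fact homeo_mulV : left_inverse homeo_one homeo_opp homeo_mul.
Proof. by move=> f; apply: homeoP => x /=; rewrite homeo_invK. Qed.
Fact homeo_mulrV : right_inverse homeo_one homeo_opp homeo_mul.
Proof. by move=> f; apply: homeoP => x /=; rewrite homeoK. Qed.

HB.instance Definition _ := isGroup.Build homeo
  homeo_mulA homeo_mul1 homeo_mulr1 homeo_mulV homeo_mulrV.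

Lemma homeoM (f g : homeo) x : (f * g) x = g (f x). Proof. by []. Qed.
Lemma homeo1 x : (1 : homeo) x = x. Proof. by []. Qed.
Lemma homeoV (f : homeo) x : f^-1 x = homeo_inv f x. Proof. by []. Qed.

End Homeomorphisms.

Section Automorphisms.
Variable G : groupType.

Record aut := Aut {
  aut_fun :> {multiplicative G -> G};
  aut_bij : bijective aut_fun }.

HB.instance Definition _ := gen_eqMixin aut.
HB.instance Definition _ := gen_choiceMixin aut.

Lemma autP (a b : aut) : a =1 b -> a = b.
Proof.
case: a b => [[a [[am]]] abij] [[b [[bm]]] bbij] /= /funext eqab.
subst b; have eqm : am = bm by exact: Prop_irrelevance.
by subst bm; congr Aut; exact: Prop_irrelevance.
Qed.

Definition aut_one : aut := @Aut idfun (Bijective (fun=> erefl) (fun=> erefl)).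

Definition aut_mul (a b : aut) : aut :=
  @Aut (b \o a) (bij_comp (aut_bij b) (aut_bij a)).

Lemma aut_inv_exists (a : aut) : exists b : aut, cancel a b /\ cancel b a.
Proof.
case: (aut_bij a) => b ab ba.
have bM : {morph b : x y / x * y} by apply: can2_gmulfM ab ba.
pose bm : {multiplicative G -> G} := HB.pack b (isMultiplicative.Build G G b bM).
by exists (@Aut bm (Bijective ba ab)).
Qed.

Definition aut_inv (a : aut) : aut := sval (cid (aut_inv_exists a)).

Fact aut_mulA : associative aut_mul. Proof. by move=> a b c; apply: autP. Qed.
Fact aut_mul1 : left_id aut_one aut_mul. Proof. by move=> a; apply: autP. Qed.
Fact aut_mulr1 : right_id aut_one aut_mul. Proof. by move=> a; apply: autP. Qed.
Fact aut_mulV : left_inverse aut_one aut_inv aut_mul.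
Proof.
by move=> a; apply: autP => x /=; rewrite /aut_inv; case: cid => b [/= _ ->].
Qed.
Fact aut_mulrV : right_inverse aut_one aut_inv aut_mul.
Proof.
by move=> a; apply: autP => x /=; rewrite /aut_inv; case: cid => b [/= -> _].
Qed.

HB.instance Definition _ := isGroup.Build aut
  aut_mulA aut_mul1 aut_mulr1 aut_mulV aut_mulrV.

End Automorphisms.

Section Units.
Variable M : monoidType.

Record monoid_unit := MonoidUnit {
  unit_val :> M;
  unitP : exists y : M, unit_val * y = 1 /\ y * unit_val = 1 }.

HB.instance Definition _ := gen_eqMixin monoid_unit.
HB.instance Definition _ := gen_choiceMixin monoid_unit.

Lemma unit_val_inj : injective unit_val.
Proof.
by move=> [u uP] [v vP] /= uv; subst v; congr MonoidUnit; exact: Prop_irrelevance.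
Qed.

Fact unit_one_subproof : exists y : M, 1 * y = 1 /\ y * 1 = 1.
Proof. by exists 1; rewrite !mulg1. Qed.

Definition unit_one := MonoidUnit unit_one_subproof.

Fact unit_mul_subproof (u v : monoid_unit) :
  exists y : M, (unit_val u * unit_val v) * y = 1 /\ y * (unit_val u * unit_val v) = 1.
Proof.
case: u v => [u [u' [uu' u'u]]] [v [v' [vv' v'v]]] /=; exists (v' * u'); split.
  by rewrite mulgA -(mulgA u) vv' mulg1.
by rewrite mulgA -(mulgA v') u'u mulg1.
Qed.

Definition unit_mul u v := MonoidUnit (unit_mul_subproof u v).

Fact unit_inv_subproof (u : monoid_unit) : exists v : monoid_unit,
  unit_val u * unit_val v = 1 /\ unit_val v * unit_val u = 1.
Proof.
case: u => [u [u' [uu' u'u]]].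
by exists (MonoidUnit (ex_intro _ u (conj u'u uu'))).
Qed.

Definition unit_inv u := sval (cid (unit_inv_subproof u)).

Fact unit_mulA : associative unit_mul.
Proof. by move=> u v w; apply: unit_val_inj => /=; rewrite mulgA. Qed.
Fact unit_mul1 : left_id unit_one unit_mul.
Proof. by move=> u; apply: unit_val_inj => /=; rewrite mul1g. Qed.
Fact unit_mulr1 : right_id unit_one unit_mul.
Proof. by move=> u; apply: unit_val_inj => /=; rewrite mulg1. Qed.
Fact unit_mulV : left_inverse unit_one unit_inv unit_mul.
Proof.
by move=> u; apply: unit_val_inj => /=; rewrite /unit_inv; case: cid => v [].
Qed.
Fact unit_mulrV : right_inverse unit_one unit_inv unit_mul.
Proof.
by move=> u; apply: unit_val_inj => /=; rewrite /unit_inv; case: cid => v [].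
Qed.

HB.instance Definition _ := isGroup.Build monoid_unit
  unit_mulA unit_mul1 unit_mulr1 unit_mulV unit_mulrV.

End Units.

Definition word (d n : nat) : Type := 'I_d -> seq 'I_n.

HB.instance Definition _ d n := Choice.copy (word d n) ('I_d -> seq 'I_n).

Section WordMonoid.
Variables d n : nat.
Implicit Types s t u : word d n.

Definition word_one : word d n := fun=> [::].
Definition word_mul s t : word d n := fun i => s i ++ t i.

Fact word_mulA : associative word_mul.
Proof. by move=> s t u; apply: funext => i; rewrite /word_mul catA. Qed.
Fact word_mul1 : left_id word_one word_mul. Proof. by []. Qed.
Fact word_mulr1 : right_id word_one word_mul.
Proof. by move=> s; apply: funext => i; rewrite /word_mul cats0. Qed.

HB.instance Definition _ := isMonoid.Build (word d n) word_mulA word_mul1 word_mulr1.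

(* b - a; only meaningful when a is a prefix of b. *)
Definition word_sub (b a : word d n) : word d n := fun i => drop (size (a i)) (b i).

Definition word_prefix s t := forall i, prefix (s i) (t i).

Lemma wordM s t i : (s * t) i = s i ++ t i. Proof. by []. Qed.

Lemma word_subK a b : word_prefix a b -> a * word_sub b a = b.
Proof.
move=> ab; apply: funext => i; rewrite wordM /word_sub.
by case/prefixP: (ab i) => z ->; rewrite drop_size_cat.
Qed.

Lemma word_mulK a t : word_sub (a * t) a = t.
Proof. by apply: funext => i; rewrite /word_sub wordM drop_size_cat. Qed.

Lemma word_mulI a t t' : a * t = a * t' -> t = t'.
Proof. by move=> e; rewrite -(word_mulK a t) e word_mulK. Qed.

End WordMonoid.

Definition cantor (n : nat) : Type := prod_topology (fun _ : nat => discrete_topology 'I_n).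

HB.instance Definition _ n := Topological.on (cantor n).

Definition cantor_power (d n : nat) : Type := prod_topology (fun _ : 'I_d => cantor n).

HB.instance Definition _ d n := Topological.on (cantor_power d n).

Section InfiniteWords.
Variable n : nat.
Implicit Types (u v w : seq 'I_n) (x y : cantor n).

Definition itake k x : seq 'I_n := @mkseq 'I_n x k.
Definition iprefix w x : Prop := itake (size w) x = w.
Definition icat w x : cantor n := fun j => nth (x (j - size w)) w j.
Definition idrop k x : cantor n := fun j => x (k + j).

(* A set with at most one element has in general no longest common prefix; lcp *)
(* is then the empty word. By lcp_word_two_points below this does not affect   *)
(* the transducer of a homeomorphism when n >= 2.                              *)
Definition is_lcp (A : set (cantor n)) w :=
  (forall x, A x -> iprefix w x) /\
  (forall v, (forall x, A x -> iprefix v x) -> prefix v w).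
Definition lcp (A : set (cantor n)) : seq 'I_n := xget [::] (is_lcp A).

Lemma size_itake k x : size (itake k x) = k. Proof. exact: size_mkseq. Qed.

Lemma nth_itake a k x j : j < k -> nth a (itake k x) j = x j.
Proof. exact: nth_mkseq. Qed.

Lemma icat_prefix w x : iprefix w (icat w x).
Proof.
case: w => // a w; apply: (@eq_from_nth _ a); rewrite size_itake // => j jw.
by rewrite nth_itake // /icat; apply: set_nth_default.
Qed.

Lemma icatK w x : idrop (size w) (icat w x) = x.
Proof.
apply: funext => j; rewrite /idrop /icat nth_default ?leq_addr //.
by rewrite addKn.
Qed.

Lemma idropK w x : iprefix w x -> icat w (idrop (size w) x) = x.
Proof.
move=> wx; apply: funext => j; rewrite /icat /idrop.
have [jw|jw] := ltnP j (size w); last by rewrite nth_default // subnKC.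
by rewrite -[X in nth _ X _]wx nth_itake.
Qed.

Lemma icat_cat u v x : icat (u ++ v) x = icat u (icat v x).
Proof.
apply: funext => j; rewrite /icat nth_cat size_cat subnDA.
by case: ltnP => // ju; [apply: set_nth_default|rewrite [RHS]nth_default].
Qed.

Lemma icat0 x : icat [::] x = x.
Proof. by apply: funext => j; rewrite /icat nth_nil subn0. Qed.

Lemma iprefix0 x : iprefix [::] x. Proof. by []. Qed.

Lemma iprefix_catE u v x :
  iprefix (u ++ v) x <-> iprefix u x /\ iprefix v (idrop (size u) x).
Proof.
split=> [uvx|[ux vx]].
  rewrite -(idropK uvx) icat_cat; split; first exact: icat_prefix.
  rewrite icatK; exact: icat_prefix.
rewrite -(idropK ux) -(idropK vx) -icat_cat; exact: icat_prefix.
Qed.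

Lemma iprefix_icat u v x : iprefix (u ++ v) (icat u x) <-> iprefix v x.
Proof.
rewrite iprefix_catE icatK; split=> [[]//|vx]; split => //; exact: icat_prefix.
Qed.

Lemma iprefixW u w x : prefix u w -> iprefix w x -> iprefix u x.
Proof. by case/prefixP=> v -> /iprefix_catE[]. Qed.

Lemma prefix_itake x k m : k <= m -> prefix (itake k x) (itake m x).
Proof.
move=> km; apply/prefixP; exists (itake (m - k) (idrop k x)).
rewrite /itake /mkseq -{1}(subnKC km) iotaD map_cat add0n; congr cat.
have -> : iota k (m - k) = map (addn k) (iota 0 (m - k)) by rewrite -iotaDl addn0.
by rewrite -map_comp.
Qed.

Lemma iprefix_itake x k : iprefix (itake k x) x.
Proof. by rewrite /iprefix size_itake. Qed.

Lemma iprefix_total u v x : iprefix u x -> iprefix v x -> size u <= size v ->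
  prefix u v.
Proof. by move=> <- <- uv; apply: prefix_itake; rewrite !size_itake in uv. Qed.

Lemma lcp_prefix A x : A x -> iprefix (lcp A) x.
Proof. by rewrite /lcp; case: xgetP => [w -> [+ _]|_ //]; exact. Qed.

Lemma is_lcp_uniq A u v : is_lcp A u -> is_lcp A v -> u = v.
Proof.
move=> [Au lu] [Av lv]; have /prefixP[t e] := lu _ Av.
have /prefixP[t' e'] := lv _ Au.
have : size t = 0.
  move/eqP: (congr1 size e); rewrite e' !size_cat -addnA -{1}(addn0 (size u)).
  by rewrite eqn_add2l eq_sym addn_eq0 => /andP[_ /eqP].
by move/eqP; rewrite size_eq0 => /eqP te; rewrite e te cats0.
Qed.

Lemma is_lcpP A w : is_lcp A w -> lcp A = w.
Proof.
by move=> Aw; apply: (@is_lcp_uniq A) => //; apply: xgetPex; exists w.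
Qed.

Lemma is_lcp_lcp (A : set (cantor n)) x y : A x -> A y -> x <> y -> is_lcp A (lcp A).
Proof.
move=> Ax Ay xy; apply: xgetPex.
have [j xyj] : exists j, x j != y j.
  apply: contrapT => /forallNP h; apply: xy; apply: funext => j.
  by move: (h j) => /negP; rewrite negbK => /eqP.
pose P k := `[< forall z, A z -> iprefix (itake k x) z >].
have P0 : exists k, P k by exists 0; apply/asboolP.
have Pb k : P k -> k <= j.
  move=> /asboolP /(_ _ Ay) e; rewrite leqNgt; apply/negP => jk.
  have := congr1 (fun w => nth (x j) w j) e.
  by rewrite size_itake !nth_itake // => /esym /eqP; rewrite (negPf xyj).
case: (ex_maxnP P0 Pb) => k /asboolP Pk kmax.
exists (itake k x); split=> // v Av.
have vx := Av _ Ax; rewrite -vx; apply: prefix_itake; apply: kmax.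
by apply/asboolP; rewrite vx.
Qed.

Lemma lcp_max (A : set (cantor n)) x y v : A x -> A y -> x <> y ->
  (forall x, A x -> iprefix v x) -> prefix v (lcp A).
Proof. by move=> Ax Ay xy; case: (is_lcp_lcp Ax Ay xy) => _; exact. Qed.

Lemma lcp_icat u (A : set (cantor n)) x y : A x -> A y -> x <> y ->
  lcp (icat u @` A) = u ++ lcp A.
Proof.
move=> Ax Ay xy; have [pA mA] := is_lcp_lcp Ax Ay xy.
apply: is_lcpP; split=> [_ [z Az <-]|v vA].
  by apply/iprefix_icat; exact: pA.
have [uv|/ltnW vu] := leqP (size u) (size v); last first.
  apply: (@prefix_trans _ u); last exact: prefix_prefix.
  by apply: (@iprefix_total _ _ (icat u x)) => //; [exact: vA (imageP _ Ax)|exact: icat_prefix].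
have /prefixP[v' ev] : prefix u v.
  by apply: (@iprefix_total _ _ (icat u x)) => //; [exact: icat_prefix|exact: vA (imageP _ Ax)].
rewrite ev prefix_catr // eqxx /=; apply: mA => z Az.
by apply/(iprefix_icat u); rewrite -ev; apply: vA; exact: imageP.
Qed.

End InfiniteWords.

Section Cones.
Variables d n : nat.
Implicit Types (s t u w : word d n) (x y : cantor_power d n).

Definition wcat w x : cantor_power d n := fun i => icat (w i) (x i).
(* x - w; only meaningful when x lies in the cone of w. *)
Definition wdrop w x : cantor_power d n := fun i => idrop (size (w i)) (x i).
Definition cone w : set (cantor_power d n) := [set x | forall i, iprefix (w i) (x i)].

Definition complete_prefix_code (F : set (word d n)) :=
  [/\ finite_set F, trivIset F cone & \bigcup_(w in F) cone w = setT].

Lemma wcat_cone w x : cone w (wcat w x).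
Proof. by move=> i; exact: icat_prefix. Qed.

Lemma wcatK w x : wdrop w (wcat w x) = x.
Proof. by apply: funext => i; exact: icatK. Qed.

Lemma wdropK w x : cone w x -> wcat w (wdrop w x) = x.
Proof. by move=> wx; apply: funext => i; apply: idropK; exact: wx. Qed.

Lemma wcatM s t x : wcat (s * t) x = wcat s (wcat t x).
Proof. by apply: funext => i; exact: icat_cat. Qed.

Lemma wcat1 x : wcat 1 x = x.
Proof. by apply: funext => i; exact: icat0. Qed.

Lemma wcatI s x y : wcat s x = wcat s y -> x = y.
Proof. by move=> e; rewrite -(wcatK s x) e wcatK. Qed.

Lemma cone1 x : cone 1 x. Proof. by move=> i. Qed.

Lemma coneP w x : cone w x <-> exists y, x = wcat w y.
Proof.
split=> [wx|[y ->]]; last exact: wcat_cone.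
by exists (wdrop w x); rewrite wdropK.
Qed.

Lemma coneM_wcat s t x : cone (s * t) (wcat s x) <-> cone t x.
Proof. by split=> h i; have := h i; rewrite /wcat wordM iprefix_icat. Qed.

Lemma coneM s t x : cone (s * t) x <-> cone s x /\ cone t (wdrop s x).
Proof.
split=> [/coneP[y ->]|[/wdropK sx tx]].
  by rewrite wcatM wcatK; split; exact: wcat_cone.
by rewrite -sx coneM_wcat.
Qed.

Definition trunc k x : word d n := fun i => itake k (x i).

Lemma trunc_cone k x : cone (trunc k x) x.
Proof. by move=> i; exact: iprefix_itake. Qed.

Lemma cone_truncP k x y :
  cone (trunc k x) y <-> forall i j, j < k -> y i j = x i j.
Proof.
split=> [h i j jk|h i].
  have := congr1 (fun v : seq 'I_n => nth (x i j : 'I_n) v j) (h i).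
  by rewrite size_itake !nth_itake.
rewrite /iprefix /trunc size_itake; apply/eq_in_map => j.
by rewrite mem_iota => /andP[_ jk]; exact: h.
Qed.

Lemma cone_trunc_le k m x y : k <= m -> cone (trunc m x) y -> cone (trunc k x) y.
Proof.
by move=> km /cone_truncP h; apply/cone_truncP => i j jk; apply: h; exact: leq_trans km.
Qed.

Lemma cone_trunc_sub w k x : (forall i, size (w i) <= k) -> cone w x ->
  cone (trunc k x) `<=` cone w.
Proof.
move=> wk wx y xy i; apply: iprefixW (xy i).
by rewrite -(wx i); exact: prefix_itake.
Qed.

End Cones.

Arguments cone {d n} w.

Lemma cvg_prod_topology (I : Type) (T : I -> topologicalType)
    (F : set_system (prod_topology T)) (x : prod_topology T) : Filter F ->
  (forall i, proj i @ F --> x i) -> F --> x.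
Proof.
move=> FF h; apply/cvg_sup => i A [_ [[B oB <-] Bx] sBA].
apply: filterS sBA _; apply: (h i B).
by apply: open_nbhs_nbhs; split.
Qed.

Section ConeTopology.
Variables d n : nat.
Implicit Types (x y : cantor_power d n).

Lemma nbhs_coneP x (A : set (cantor_power d n)) :
  nbhs x A <-> exists k, cone (trunc k x) `<=` A.
Proof.
split=> [xA|[k kA]].
  pose F := filter_from [set: nat] (fun k => cone (trunc k x)).
  have FF : Filter F.
    apply: filter_from_filter; first by exists 0.
    move=> k m _ _; exists (maxn k m) => // y xy.
    by split; apply: cone_trunc_le xy; rewrite ?leq_maxl ?leq_maxr.
  have : F --> x.
    apply: cvg_prod_topology => i.
    apply: cvg_prod_topology => j /=.
    apply/discrete_cvg; exists j.+1 => // y /cone_truncP /(_ i j (ltnSn j)).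
    by [].
  by move=> /(_ _ xA) [k _ kA]; exists k.
apply: filterS kA _.
suff : \forall y \near x, forall ij : 'I_d * 'I_k,
    (y : cantor_power d n) ij.1 (ij.2 : nat) = x ij.1 (ij.2 : nat).
  apply: filterS => y h; apply/cone_truncP => i j jk.
  exact: (h (i, Ordinal jk)).
apply: (@filter_forall _ _ (fun (ij : 'I_d * 'I_k) (y : cantor_power d n) =>
    y ij.1 (ij.2 : nat) = x ij.1 (ij.2 : nat)) (nbhs x) (nbhs_filter x)) => -[i j] /=.
have ci := @proj_continuous _ (fun=> cantor n) i x.
have cj := @proj_continuous nat (fun=> discrete_topology 'I_n) j (x i).
have Aj : nbhs (x i) [set z : cantor n | z j = x i j].
  have dj := discrete_set1 (x i j).
  exact: (cj _ dj).
exact: (ci _ Aj).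
Qed.

End ConeTopology.

Section BrinThompson.
Variables d n : nat.
Implicit Types (f g : homeo (cantor_power d n)) (F : set (word d n)).

(* f is the homeomorphism f_phi for the bijection phi : F1 -> F2. *)
Definition prefix_exchange f F1 F2 (phi : word d n -> word d n) :=
  [/\ complete_prefix_code F1, complete_prefix_code F2, set_bij F1 F2 phi &
      forall w x, F1 w -> cone w x -> f x = wcat (phi w) (wdrop w x)].

Definition dV_pred : {pred homeo (cantor_power d n)} :=
  fun f => `[< exists F1 F2 phi, prefix_exchange f F1 F2 phi >].

Lemma dV_intro f (c0 : cantor_power d n) (J : choiceType) (P : set J)
    (a b : J -> word d n) :
  finite_set P -> trivIset P (cone \o a) -> \bigcup_(i in P) cone (a i) = setT ->
  (forall i x, P i -> cone (a i) x -> f x = wcat (b i) (wdrop (a i) x)) ->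
  f \in dV_pred.
Proof.
move=> finP triva cova fab; apply/asboolP.
have fa i y : P i -> f (wcat (a i) y) = wcat (b i) y.
  by move=> Pi; rewrite (fab i) ?wcatK //; exact: wcat_cone.
have cbP i z : P i -> cone (b i) z -> cone (a i) (homeo_inv f z).
  by move=> Pi /coneP[y ->]; rewrite -fa // homeoK; exact: wcat_cone.
have ainj i j : P i -> P j -> a i = a j -> i = j.
  move=> Pi Pj e; apply: triva => //=; exists (wcat (a i) c0).
  by split; rewrite /= ?e; exact: wcat_cone.
have trivb : trivIset P (cone \o b).
  move=> i j Pi Pj [z [/= iz jz]]; apply: triva => //.
  by exists (homeo_inv f z); split; exact: cbP.
have binj i j : P i -> P j -> b i = b j -> i = j.
  move=> Pi Pj e; apply: trivb => //=; exists (wcat (b i) c0).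
  by split; rewrite /= ?e; exact: wcat_cone.
have [i0 Pi0 _] : (\bigcup_(i in P) cone (a i)) c0 by rewrite cova.
pose phi w := b (xget i0 [set i | P i /\ a i = w]).
have phia i : P i -> phi (a i) = b i.
  move=> Pi; rewrite /phi; congr b.
  have [] : [set j | P j /\ a j = a i] (xget i0 [set j | P j /\ a j = a i]).
    by apply: xgetPex; exists i.
  by move=> Pj e; apply: ainj.
exists (a @` P), (b @` P), phi; split.
- split; first exact: finite_image.
    move=> _ _ [i Pi <-] [j Pj <-] ij; congr a; exact: triva.
  by rewrite bigcup_image.
- split; first exact: finite_image.
    move=> _ _ [i Pi <-] [j Pj <-] ij; congr b; exact: trivb.
  rewrite bigcup_image -subTset => z _.
  have [i Pi /coneP[y e]] : (\bigcup_(i in P) cone (a i)) (homeo_inv f z) by rewrite cova.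
  by exists i => //; apply/coneP; exists y; rewrite -fa // -e homeo_invK.
- split.
  + by move=> _ [i Pi <-]; exists i => //; rewrite phia.
  + move=> w w' /set_mem[i Pi <-] /set_mem[j Pj <-].
    by rewrite !phia // => /binj ->.
  + by move=> _ [i Pi <-]; exists (a i); [exists i|rewrite phia].
- by move=> _ x [i Pi <-] aix; rewrite phia //; exact: fab.
Qed.

Lemma dV1 : 1 \in dV_pred.
Proof.
have code1 : complete_prefix_code [set (1 : word d n)].
  split; [exact: finite_set1|by move=> ? ? -> ->|].
  by rewrite bigcup_set1 -subTset => x _; exact: cone1.
apply/asboolP; exists [set 1], [set 1], id; split=> //.
  by split=> // w ->; exists 1.
by move=> w x -> x1; rewrite wdropK.
Qed.

Lemma dV_empty f : (cantor_power d n -> False) -> f \in dV_pred.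
Proof. by move=> h; rewrite (_ : f = 1) ?dV1 //; apply: homeoP => x; case: (h x). Qed.

Lemma dVV f : f \in dV_pred -> f^-1 \in dV_pred.
Proof.
have [[c0]|/forallNP h _] := pselect (exists c : cantor_power d n, True); last first.
  by apply: dV_empty => x; apply: (h x).
move=> _ /asboolP[F1 [F2 [phi [[finF1 _ _] [finF2 triv2 cov2] [phiF phiI phiS] fphi]]]].
apply: (@dV_intro _ c0 _ F1 phi id) => //=.
- move=> v w Fv Fw [z [vz wz]]; apply: phiI; rewrite ?inE //.
  by apply: triv2; [exact: phiF|exact: phiF|exists z].
- rewrite -subTset => z _.
  have [v Fv vz] : (\bigcup_(w in F2) cone w) z by rewrite cov2.
  by have [w Fw e] := phiS _ Fv; exists w => //; rewrite e.
- move=> w z Fw /coneP[y ->]; rewrite wcatK -{1}(wcatK w y) -(fphi w) //.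
    exact: homeoK.
  exact: wcat_cone.
Qed.

Lemma dVM f g : f \in dV_pred -> g \in dV_pred -> f * g \in dV_pred.
Proof.
have [[c0]|/forallNP h _ _] := pselect (exists c : cantor_power d n, True); last first.
  by apply: dV_empty => x; apply: (h x).
move=> _ /asboolP[F1 [F2 [phi [[finF1 triv1 cov1] _ _ fphi]]]].
move=> /asboolP[G1 [G2 [psi [[finG1 trivG covG] _ _ gpsi]]]].
pose P := [set p : word d n * word d n |
  [/\ F1 p.1, G1 p.2 & exists z, cone (phi p.1) z /\ cone p.2 z]].
pose m (p : word d n * word d n) : word d n := fun i =>
  if size (phi p.1 i) <= size (p.2 i) then p.2 i else phi p.1 i.
have prefm p : P p -> word_prefix (phi p.1) (m p) /\ word_prefix p.2 (m p).
  move=> [_ _ [z [z1 z2]]]; split=> i; rewrite /m; case: leqP => [le|/ltnW le]; rewrite ?prefix_refl //.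
    by apply: iprefix_total le; [exact: z1|exact: z2].
  by apply: iprefix_total le; [exact: z2|exact: z1].
have mP p z : P p -> cone (m p) z <-> cone (phi p.1) z /\ cone p.2 z.
  move=> Pp; have [m1 m2] := prefm _ Pp; split=> [mz|[z1 z2] i].
    by split=> i; [apply: iprefixW (m1 i) _|apply: iprefixW (m2 i) _]; exact: mz.
  by rewrite /m; case: ifP => _; [exact: z2|exact: z1].
pose a (p : word d n * word d n) := p.1 * word_sub (m p) (phi p.1).
pose b (p : word d n * word d n) := psi p.2 * word_sub (m p) p.2.
have aP p x : P p -> cone (a p) x <-> cone p.1 x /\ cone p.2 (f x).
  move=> Pp; have [F1p _ _] := Pp; have [m1 _] := prefm _ Pp.
  have key y : cone (a p) (wcat p.1 y) <-> cone p.2 (f (wcat p.1 y)).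
    rewrite coneM_wcat (fphi p.1) ?wcatK //; last exact: wcat_cone.
    rewrite -(coneM_wcat (phi p.1)) word_subK // mP //.
    by split=> [[]//|h]; split=> //; exact: wcat_cone.
  split=> [apx|[/coneP[y ->] /key]//].
  have /coneP[y e] : cone p.1 x by move: apx => /coneM[].
  by move: apx; rewrite e => /key; split=> //; exact: wcat_cone.
apply: (@dV_intro _ c0 _ P a b).
- by apply: sub_finite_set (finite_setX finF1 finG1) => p [].
- move=> [v v'] [w w'] Pp Pq [x [/=]].
  move=> /(aP _ _ Pp)[/= vx v'x] /(aP _ _ Pq)[/= wx w'x].
  move: Pp Pq => [/= Fv Gv' _] [/= Fw Gw' _]; congr pair.
    by apply: triv1 => //; exists x.
  by apply: trivG => //; exists (f x).
- rewrite -subTset => x _.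
  have [w Fw wx] : (\bigcup_(w in F1) cone w) x by rewrite cov1.
  have [v Gv vx] : (\bigcup_(w in G1) cone w) (f x) by rewrite covG.
  have Pp : P (w, v).
    split=> //; exists (f x); split=> //=.
    by rewrite (fphi w) //; exact: wcat_cone.
  by exists (w, v) => //; apply/aP.
- move=> p x Pp /coneP[y ->]; rewrite wcatK homeoM.
  have [F1p G1p _] := Pp; have [m1 m2] := prefm _ Pp.
  rewrite wcatM (fphi p.1) ?wcatK //; last exact: wcat_cone.
  rewrite -wcatM word_subK // -{1}(word_subK m2) wcatM.
  by rewrite (gpsi p.2) ?wcatK ?wcatM //; exact: wcat_cone.
Qed.

Lemma dV_div : divg_closed dV_pred.
Proof. by move=> f g fV gV; apply: dVM => //; exact: dVV. Qed.

HB.instance Definition _ := isMul1Closed.Build (homeo (cantor_power d n)) dV_pred dV1.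
HB.instance Definition _ := isMulClosed.Build (homeo (cantor_power d n)) dV_pred dVM.
HB.instance Definition _ := isInvClosed.Build (homeo (cantor_power d n)) dV_pred dVV.

Record dV := DV { dV_val :> homeo (cantor_power d n); dV_valP : dV_val \in dV_pred }.

HB.instance Definition _ := [isSub for dV_val].
HB.instance Definition _ := [Choice of dV by <:].
HB.instance Definition _ := SubChoice_isSubGroup.Build _ dV_pred dV (conj dV1 dV_div).

End BrinThompson.

Section Transducers.
Variables d n : nat.

Record transducer := Transducer {
  states : choiceType;
  trans : states -> word d n -> states;
  output : states -> word d n -> word d n;
  trans1 : forall q, trans q 1 = q;
  transM : forall q s t, trans q (s * t) = trans (trans q s) t;
  outputM : forall q s t, output q (s * t) = output q s * output (trans q s) t }.

Definition synchronizing (T : transducer) : Prop :=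
  exists k : nat, forall (p q : states T) (w : word d n),
    (forall i, k <= size (w i)) -> trans p w = trans q w.

Section Quotient.
Variable T : transducer.

Definition output_equiv : rel (states T) :=
  fun p q => `[< forall s, output p s = output q s >].

Fact output_equiv_refl : reflexive output_equiv.
Proof. by move=> p; apply/asboolP. Qed.
Fact output_equiv_sym : symmetric output_equiv.
Proof. by move=> p q; apply/asboolP/asboolP => h s; rewrite h. Qed.
Fact output_equiv_trans : transitive output_equiv.
Proof.
by move=> q p r /asboolP pq /asboolP qr; apply/asboolP => s; rewrite pq.
Qed.

Canonical output_equiv_rel :=
  EquivRel output_equiv output_equiv_refl output_equiv_sym output_equiv_trans.

Definition quotient_states := {eq_quot output_equiv}.

HB.instance Definition _ := Choice.on quotient_states.
HB.instance Definition _ := EqQuotient.on quotient_states.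

Definition quotient_trans (q : quotient_states) s : quotient_states :=
  \pi_quotient_states (trans (repr q) s).
Definition quotient_output (q : quotient_states) s := output (repr q) s.

Lemma output_equivP p q :
  \pi_quotient_states p = \pi_quotient_states q <->
  forall s, output p s = output q s.
Proof. by split=> [/eqmodP/asboolP//|h]; apply/eqmodP/asboolP. Qed.

Lemma output_repr p s : output (repr (\pi_quotient_states p)) s = output p s.
Proof. by have /output_equivP := reprK (\pi_quotient_states p); exact. Qed.

Lemma quotient_transE p s :
  quotient_trans (\pi_quotient_states p) s = \pi_quotient_states (trans p s).
Proof.
apply/output_equivP => t; apply: (@word_mulI _ _ (output p s)).
by rewrite -outputM -{1}output_repr -outputM output_repr.
Qed.

Fact quotient_trans1 q : quotient_trans q 1 = q.
Proof. by rewrite /quotient_trans trans1 reprK. Qed.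
Fact quotient_transM q s t :
  quotient_trans q (s * t) = quotient_trans (quotient_trans q s) t.
Proof. by rewrite {3}/quotient_trans quotient_transE /quotient_trans transM. Qed.
Fact quotient_outputM q s t : quotient_output q (s * t) =
  quotient_output q s * quotient_output (quotient_trans q s) t.
Proof. by rewrite /quotient_output outputM /quotient_trans output_repr. Qed.

Definition quotient_transducer :=
  Transducer quotient_trans1 quotient_transM quotient_outputM.

Lemma synchronizing_quotient : synchronizing quotient_transducer <->
  exists k, forall (p q : states T) w, (forall i, k <= size (w i)) ->
    forall s, output (trans p w) s = output (trans q w) s.
Proof.
split=> -[k h]; exists k => p q w kw.
  apply/output_equivP; rewrite -!quotient_transE.
  exact: (h (\pi_quotient_states p) (\pi_quotient_states q)).
by apply/output_equivP; exact: h.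
Qed.

End Quotient.

End Transducers.

Lemma lcp_degenerate n (A : set (cantor n)) : n <= 1 -> lcp A = [::].
Proof.
move=> n1; rewrite /lcp; case: xgetP => // w _ [Aw lw].
have eqI (a b : 'I_n) : a = b.
  apply: val_inj => /=.
  have := leq_trans (ltn_ord a) n1; have := leq_trans (ltn_ord b) n1.
  by case: (nat_of_ord a) => //; case: (nat_of_ord b).
case: w Aw lw => // a w _ /(_ (a :: a :: w)) lw.
have /lw/size_prefix : forall x, A x -> iprefix (a :: a :: w) x.
  by move=> x Ax; apply: (@eq_from_nth _ a); rewrite ?size_itake.
by rewrite /= ltnn.
Qed.

Section HomeoTransducer.
Variables d n : nat.
Implicit Types (f g h : homeo (cantor_power d n)) (s t w : word d n).

(* The i-th coordinate is the longest common prefix of ((s C_n^d) h) pi_i. *)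
Definition lcp_word h s : word d n := fun i => lcp (proj i @` (h @` cone s)).

Lemma cone_nbhs w x : cone w x -> nbhs x (cone w).
Proof.
move=> wx; apply/nbhs_coneP; exists (\max_i size (w i)).
apply: cone_trunc_sub wx => i; exact: leq_bigmax.
Qed.

Lemma homeo_cone f x m : exists k,
  forall y, cone (trunc k x) y -> cone (trunc m (f x)) (f y).
Proof.
have /(_ (cone (trunc m (f x)))) := @homeo_continuous _ f x.
by move=> /(_ (cone_nbhs (trunc_cone _ _))) /nbhs_coneP [k h]; exists k.
Qed.

Lemma proj_two_points f s i : 1 < n -> exists x y,
  [/\ cone s x, cone s y & f x i <> f y i].
Proof.
move=> n1; pose x := wcat s (fun _ _ => Ordinal (ltnW n1)).
have sx : cone s x by exact: wcat_cone.
have [m hm] : exists m, cone (trunc m (f x)) `<=` homeo_inv f @^-1` cone s.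
  apply/nbhs_coneP; apply: (@homeo_inv_continuous _ f (f x)).
  by rewrite homeoK; exact: cone_nbhs.
have other (a : 'I_n) : exists b : 'I_n, b <> a.
  have [->|/eqP h] := eqVneq a (Ordinal (ltnW n1)); last first.
    by exists (Ordinal (ltnW n1)) => /esym/h.
  by exists (Ordinal n1).
have [b hb] := other (f x i m).
pose z : cantor_power d n := fun i' j => if j == m then b else f x i' j.
exists x, (homeo_inv f z); split=> //.
  apply: hm; apply/cone_truncP => i' j jm.
  by rewrite /z ltn_eqF.
rewrite homeo_invK => /(congr1 (fun u : cantor n => u m)).
by rewrite /z eqxx => /esym.
Qed.

Lemma lcp_word_two_points f s i : 1 < n -> exists x y,
  [/\ (proj i @` (f @` cone s)) x, (proj i @` (f @` cone s)) y & x <> y].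
Proof.
move=> n1; have [x [y [sx sy xy]]] := @proj_two_points f s i n1.
exists (f x i), (f y i); split=> //.
  by exists (f x) => //; exists x.
by exists (f y) => //; exists y.
Qed.

Lemma lcp_word_prefix f s x : cone s x -> cone (lcp_word f s) (f x).
Proof.
by move=> sx i; apply: lcp_prefix; exists (f x) => //; exists x.
Qed.

Lemma lcp_wordM f s t : word_prefix (lcp_word f s) (lcp_word f (s * t)).
Proof.
move=> i; have [n1|n1] := leqP n 1.
  by rewrite {1}/lcp_word lcp_degenerate // prefix0s.
have [x [y [Ax Ay xy]]] := @lcp_word_two_points f (s * t) i n1.
apply: lcp_max Ax Ay xy _ => _ [_ [z /coneM[sz _] <-] <-].
exact: lcp_word_prefix.
Qed.

Definition homeo_output h s t : word d n :=
  word_sub (lcp_word h (s * t)) (lcp_word h s).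

Lemma lcp_word_output h s t : lcp_word h s * homeo_output h s t = lcp_word h (s * t).
Proof. by rewrite word_subK //; exact: lcp_wordM. Qed.

Fact homeo_outputM h q s t :
  homeo_output h q (s * t) = homeo_output h q s * homeo_output h (q * s) t.
Proof.
apply: (@word_mulI _ _ (lcp_word h q)).
by rewrite mulgA !lcp_word_output mulgA.
Qed.

(* homeo_transducer h and min_transducer h are T_h and M_h; dS and dB are     *)
(* dS_{n,1} and dB_{n,1}.                                                     *)
Definition homeo_transducer h : transducer d n :=
  @Transducer d n (word d n) *%g (homeo_output h)
    (@mulg1 _) (@mulgA _) (homeo_outputM h).

Definition min_transducer h : transducer d n :=
  quotient_transducer (homeo_transducer h).

Definition dS_pred : {pred homeo (cantor_power d n)} :=
  fun f => `[< synchronizing (min_transducer f) >].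

Definition state_equiv f s s' := homeo_output f s =1 homeo_output f s'.

Lemma dSP f : f \in dS_pred <-> exists k, forall p q w,
  (forall i, k <= size (w i)) -> state_equiv f (p * w) (q * w).
Proof.
split=> [/asboolP/synchronizing_quotient//|h].
exact/asboolP/synchronizing_quotient.
Qed.

Lemma dS_degenerate f : n <= 1 -> f \in dS_pred.
Proof.
move=> n1; apply/dSP; exists 0 => p q w _ t; apply: funext => i.
by rewrite /homeo_output /word_sub /lcp_word !lcp_degenerate.
Qed.

Lemma state_equiv_local f s s' u u' phi : 1 < n ->
  (forall x, f (wcat s x) = wcat u (phi x)) ->
  (forall x, f (wcat s' x) = wcat u' (phi x)) -> state_equiv f s s'.
Proof.
move=> n1 fs fs'.
suff key r v : (forall x, f (wcat r x) = wcat v (phi x)) ->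
    forall t i, lcp_word f (r * t) i = v i ++ lcp (proj i @` (phi @` cone t)).
  move=> t; apply: funext => i; rewrite /homeo_output /word_sub.
  rewrite -{1}(mulg1 s) -{1}(mulg1 s') !(key _ _ fs) !(key _ _ fs').
  by rewrite !size_cat !drop_cat !ltnNge !leq_addr /= !addKn.
move=> fr t i; have [x [y [rtx rty xy]]] := @proj_two_points f (r * t) i n1.
move: rtx rty xy => /coneP[x' ->] /coneP[y' ->].
rewrite !wcatM !fr => xy.
rewrite -(@lcp_icat _ _ _ (phi (wcat t x') i) (phi (wcat t y') i)).
- congr lcp; apply/seteqP; split.
    move=> _ [_ [z /coneP[z' ->] <-] <-]; rewrite wcatM fr.
    exists (phi (wcat t z') i) => //; exists (phi (wcat t z')) => //.
    by exists (wcat t z') => //; exact: wcat_cone.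
  move=> _ [_ [_ [z tz <-] <-] <-]; exists (f (wcat r z)); last by rewrite fr.
  by exists (wcat r z) => //; apply/coneM_wcat.
- exists (phi (wcat t x')) => //; exists (wcat t x') => //; exact: wcat_cone.
- exists (phi (wcat t y')) => //; exists (wcat t y') => //; exact: wcat_cone.
- by move=> e; apply: xy; rewrite /wcat e.
Qed.

Lemma dS1 : 1 \in dS_pred.
Proof.
have [n1|n1] := leqP n 1; first exact: dS_degenerate.
apply/dSP; exists 0 => p q w _.
exact: (@state_equiv_local 1 _ _ (p * w) (q * w) id).
Qed.

Lemma cantor_power_compact : compact [set: cantor_power d n].
Proof.
have c0 : compact [set: discrete_topology 'I_n].
  by apply: finite_compact; exact: (@finite_finset 'I_n).
have c1 : compact [set: cantor n].
  have := @tychonoff nat (fun=> discrete_topology 'I_n) (fun=> setT) (fun=> c0).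
  by congr (compact _); rewrite eqEsubset.
have := @tychonoff 'I_d (fun=> cantor n) (fun=> setT) (fun=> c1).
by congr (compact _); rewrite eqEsubset.
Qed.

Lemma homeo_uniform f m : exists k, forall x y,
  cone (trunc k x) y -> cone (trunc m (f x)) (f y).
Proof.
have /compact_near_coveringP/(_ nat \oo
  (fun k x => forall y, cone (trunc k x) y -> cone (trunc m (f x)) (f y))) := cantor_power_compact.
case=> [x _|k _ h]; last by exists k => x; apply: (h k) => //=.
have [k hk] := homeo_cone f x m.
exists (cone (trunc k x), [set k' | k <= k']).
  by split=> /=; [exact: cone_nbhs (trunc_cone _ _)|exists k].
move=> [x' k'] /= [xx' kk'] y x'y.
have xy : cone (trunc k x) y.
  move: xx' x'y; rewrite !cone_truncP => xx' x'y i j jk.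
  by rewrite x'y ?xx' // (leq_trans jk).
move: (hk _ xx') (hk _ xy); rewrite !cone_truncP => hx' hy i j jm.
by rewrite hy ?hx'.
Qed.

Lemma lcp_word_growth f m : 1 < n -> exists k, forall w,
  (forall i, k <= size (w i)) -> forall i, m <= size (lcp_word f w i).
Proof.
move=> n1; have [k hk] := homeo_uniform f m; exists k => w kw i.
have [_ [_ [[_ [x wx <-] <-] [_ [y wy <-] <-] xy]]] := @lcp_word_two_points f w i n1.
rewrite -(size_itake m (f x i)); apply: size_prefix.
apply: (lcp_max _ _ xy); [by exists (f x) => //; exists x|by exists (f y) => //; exists y|].
move=> _ [_ [z wz <-] <-]; apply: (hk x z) => i'.
by apply: iprefixW (wz i'); rewrite -(wx i'); exact: prefix_itake.
Qed.

Definition local_map f s (x : cantor_power d n) : cantor_power d n :=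
  wdrop (lcp_word f s) (f (wcat s x)).

Lemma local_mapE f s x : f (wcat s x) = wcat (lcp_word f s) (local_map f s x).
Proof. by rewrite wdropK //; apply: lcp_word_prefix; exact: wcat_cone. Qed.

Lemma local_map_cone f s t x : cone t x -> cone (homeo_output f s t) (local_map f s x).
Proof.
move=> tx; rewrite -(coneM_wcat (lcp_word f s)) lcp_word_output -local_mapE.
by apply: lcp_word_prefix; rewrite coneM_wcat.
Qed.

Lemma state_equivP f s s' : 1 < n -> state_equiv f s s' <-> local_map f s = local_map f s'.
Proof.
move=> n1; split=> [ss'|e]; last first.
  apply: (@state_equiv_local _ _ _ (lcp_word f s) (lcp_word f s') (local_map f s)) => // x.
    exact: local_mapE.
  by rewrite e; exact: local_mapE.
apply: funext => x; apply: funext => i; apply: funext => j.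
have [k hk] := lcp_word_growth f (size (lcp_word f s i) + j.+1) n1.
have tx := @trunc_cone _ _ k x.
have := local_map_cone f s tx i; have := local_map_cone f s' tx i; rewrite -ss'.
have jt : j < size (homeo_output f s (trunc k x) i).
  rewrite /homeo_output /word_sub size_drop ltn_subRL -addnS.
  by apply: hk => i'; rewrite wordM size_cat size_itake leq_addl.
set v := homeo_output _ _ _ _ in jt *.
move=> /(congr1 (fun u : seq 'I_n => nth (x i j : 'I_n) u j)); rewrite nth_itake // => ->.
by move=> /(congr1 (fun u : seq 'I_n => nth (x i j : 'I_n) u j)); rewrite nth_itake.
Qed.

Lemma lcp_word_bound f k : exists m, forall w,
  (forall i, size (w i) = k) -> forall i, size (lcp_word f w i) <= m.
Proof.
pose W (t : {ffun 'I_d -> k.-tuple 'I_n}) : word d n := fun i => t i.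
exists (\max_t \max_i size (lcp_word f (W t) i)) => w kw i.
pose t := [ffun i => tcast (kw i) (in_tuple (w i))].
have -> : w = W t by apply: funext => i'; rewrite /W ffunE val_tcast.
exact: leq_trans (leq_bigmax i) (leq_bigmax t).
Qed.

Lemma dSM f g : f \in dS_pred -> g \in dS_pred -> f * g \in dS_pred.
Proof.
have [n1|n1] := leqP n 1; first by move=> *; exact: dS_degenerate.
move=> /dSP[kf hf] /dSP[kg hg]; apply/dSP.
have [m hm] := lcp_word_bound f kf.
have [K hK] := lcp_word_growth f (m + kg) n1.
exists (maxn kf K) => p q w Kw.
have kfw i : kf <= size (w i) by rewrite (leq_trans _ (Kw i)) // leq_maxl.
pose w1 : word d n := fun i => take kf (w i).
pose w2 : word d n := fun i => drop kf (w i).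
have ew : w = w1 * w2 by apply: funext => i; rewrite wordM cat_take_drop.
have sw1 i : size (w1 i) = kf by rewrite size_takel.
have outE r : homeo_output f (r * w1) w2 = homeo_output f w1 w2.
  by rewrite -{2}(mul1g w1); apply: hf => i; rewrite sw1.
have lE r : lcp_word f (r * w) = lcp_word f (r * w1) * homeo_output f w1 w2.
  by rewrite -(outE r) lcp_word_output -mulgA -ew.
have eqf := hf p q w kfw; rewrite state_equivP // in eqf.
have eqg : local_map g (lcp_word f (p * w)) = local_map g (lcp_word f (q * w)).
  apply/state_equivP => //; rewrite !lE; apply: hg => i.
  have := hK w _ i; rewrite ew -lcp_word_output wordM size_cat -ew => hi.
  rewrite -(leq_add2l (size (lcp_word f w1 i))).
  apply: leq_trans (hi _); first by rewrite leq_add2r hm.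
  by move=> i'; rewrite (leq_trans _ (Kw i')) // leq_maxr.
apply: (@state_equiv_local _ _ _ (lcp_word g (lcp_word f (p * w)))
  (lcp_word g (lcp_word f (q * w)))
  (local_map g (lcp_word f (p * w)) \o local_map f (p * w))) => // x.
  by rewrite homeoM local_mapE local_mapE.
by rewrite homeoM local_mapE local_mapE -eqf -eqg.
Qed.

Record dS := DS { dS_val :> homeo (cantor_power d n); dS_valP : dS_val \in dS_pred }.

HB.instance Definition _ := [isSub for dS_val].
HB.instance Definition _ := [Choice of dS by <:].
HB.instance Definition _ :=
  SubChoice_isSubMonoid.Build _ dS_pred dS (conj dS1 dSM).

End HomeoTransducer.

Definition dB (d n : nat) := monoid_unit (dS d n).
HB.instance Definition _ d n := Group.on (dB d n).

(* Main.v *)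
From HB Require Import structures.
Require Import Defs.
From mathcomp Require Import all_boot.
From mathcomp Require Import all_classical topology.

(* Write V for dV_n and X for the d-th power of Cantor space. The proof that  *)
(* every automorphism a of V is conjugation by a unique homeomorphism of X is *)
(* a Rubin-type argument. Disjointness of supports can nearly be expressed in *)
(* the group language, so the image under a of the elements of V that are     *)
(* trivial on a cone has a common fixed point; by compactness the elements    *)
(* that are trivial near x have images with a common fixed point y. An        *)
(* involution of V fixing a point is trivial near it, whence y is unique and  *)
(* x |-> y is invertible; it is the conjugating homeomorphism.                *)
(* A homeomorphism h satisfies V ^ h <= V iff M_h is synchronizing:           *)
(* conjugating the swap of two disjoint cones p and q by h forces             *)
(* the states pw and qw to agree for all long w, uniformly because only       *)
(* finitely many pairs p, q are needed to erase prefixes letter by letter;    *)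
(* conversely, equal states at long words make V ^ h act locally by prefix    *)
(* replacement. Hence the units of dS_{n,1} are the normalizer of V.          *)

Set Implicit Arguments.
Unset Strict Implicit.
Unset Printing Implicit Defensive.

Import Algebra.
Local Open Scope classical_set_scope.
Local Open Scope group_scope.

(** The isomorphism is [aut_dB], sending an automorphism [a] to the homeomorphism [aut_homeo a] that
    induces it by conjugation ([aut_homeoJ]); its inverse [dB_aut] sends a unit to conjugation by
    it. That these are mutually inverse and multiplicative rests on [dV_centralizer_homeo]: a
    homeomorphism is determined by its conjugation action on V. The reconstruction of points rests
    on [aut_common_fixed_point] and [involution_trivial_near]. The link with transducers is
    [dS_normalizes_dV] in one direction and [normalizer_dS] in the other. *)

(** * Elements of V as local prefix replacements, and swaps of two disjoint cones *)

Section PrefixMaps.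
Variables d n : nat.
Local Notation X := (cantor_power d n).
Implicit Types (p q w : word d n) (x y z : X) (f : homeo X).

Lemma trunc_subword k m x : k <= m -> exists r : word d n,
  trunc m x = trunc k x * r /\ forall i, size (r i) = m - k.
Proof.
move=> km; have tk : word_prefix (trunc k x) (trunc m x).
  by move=> i; exact: prefix_itake.
exists (word_sub (trunc m x) (trunc k x)); split; first by rewrite word_subK.
by move=> i; rewrite /word_sub size_drop !size_itake.
Qed.

Lemma cone_trunc_eq k x y : cone (trunc k x) y -> trunc k y = trunc k x.
Proof.
by move=> h; apply: funext => i; have := h i; rewrite /iprefix /trunc size_itake.
Qed.

Lemma word_bound w : exists k, forall i, size (w i) <= k.
Proof. by exists (\max_i size (w i)) => i; exact: leq_bigmax. Qed.

Lemma wcat_eq_bounded k (b : word d n) y z :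
  (forall i, k <= size (b i)) -> cone (trunc k (wcat b y)) (wcat b z).
Proof.
move=> kb; apply/cone_truncP => i j jk.
by rewrite /wcat /icat; apply: set_nth_default; exact: leq_trans (kb i).
Qed.

(** For homeomorphisms this pointwise condition characterizes V without mentioning codes.
    Truncations to equal length in all coordinates suffice, since they give a neighbourhood
    basis. *)
Definition locally_prefix (f : X -> X) := forall x, exists m (b : word d n),
  forall z, f (wcat (trunc m x) z) = wcat b z.

Lemma locally_prefix_continuous (f : X -> X) : locally_prefix f -> continuous f.
Proof.
move=> fl x A /nbhs_coneP[k kA]; apply/nbhs_coneP.
have [m [b fb]] := fl x; exists (m + k) => y xy; apply: kA.
have [r [er sr]] := trunc_subword x (leq_addr k m).
have /coneP[x' ->] := trunc_cone (m + k) x.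
move: xy => /coneP[y' ->]; rewrite er !wcatM !fb -!wcatM.
by apply: wcat_eq_bounded => i; rewrite wordM size_cat sr addKn leq_addl.
Qed.

Lemma locally_prefix_uniform f : locally_prefix f -> exists m, forall x,
  exists b : word d n, forall z, f (wcat (trunc m x) z) = wcat b z.
Proof.
move=> fl; have /compact_near_coveringP/(_ nat \oo (fun m x => exists b : word d n,
  forall z, f (wcat (trunc m x) z) = wcat b z)) := @cantor_power_compact d n.
case=> [x _|m _ h]; last by exists m => x; apply: (h m) => //=.
have [m [b fb]] := fl x.
exists (cone (trunc m x), [set k | m <= k]).
  by split=> /=; [exact: cone_nbhs (trunc_cone _ _)|exists m].
move=> [y k] /= [xy mk]; have [r [-> _]] := trunc_subword y mk.
by exists (b * r) => z; rewrite (cone_trunc_eq xy) !wcatM fb.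
Qed.

(** For the converse, compactness gives one depth [m] for all points, and the words of length [m] in
    every coordinate form a complete prefix code. Families of tuples index this code so that its
    finiteness is immediate. *)
Lemma dV_locally_prefix f : f \in @dV_pred d n <-> locally_prefix f.
Proof.
split=> [/asboolP[F1 [F2 [phi [[_ _ cov] _ _ fphi]]]] x|].
  have [w Fw wx] : (\bigcup_(w in F1) cone w) x by rewrite cov.
  have [m wm] := word_bound w; exists m.
  have wt : word_prefix w (trunc m x).
    by move=> i; rewrite -(wx i); exact: prefix_itake.
  exists (phi w * word_sub (trunc m x) w) => z.
  rewrite -{1}(word_subK wt) wcatM (fphi w) ?wcatK ?wcatM //; exact: wcat_cone.
move=> /locally_prefix_uniform[m fm].
have [[c0 _]|/forallNP h] := pselect (exists c : X, True); last first.
  by apply: dV_empty => x; apply: (h x).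
pose a (t : {ffun 'I_d -> m.-tuple 'I_n}) : word d n := fun i => t i.
have sa t i : size (a t i) = m by rewrite size_tuple.
have aE t z : trunc m (wcat (a t) z) = a t.
  by apply: funext => i; have := wcat_cone (a t) z i; rewrite /iprefix sa.
have fb t : exists b : word d n, forall z, f (wcat (a t) z) = wcat b z.
  by have := fm (wcat (a t) c0); rewrite aE.
apply: (@dV_intro _ _ f c0 _ setT a (fun t => sval (cid (fb t)))).
- exact: finite_finset.
- move=> s t _ _ [x [/coneP[y xy] /coneP[z xz]]]; apply/ffunP => i; apply: val_inj.
  by have := congr1 (fun w : word d n => w i) (aE s y); rewrite -xy xz aE.
- rewrite -subTset => x _; have sx i : size (trunc m x i) == m by rewrite size_itake.
  exists [ffun i => Tuple (sx i)] => //.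
  suff -> : a [ffun i => Tuple (sx i)] = trunc m x by exact: trunc_cone.
  by apply: funext => i; rewrite /a ffunE.
- by move=> t x _ /coneP[z ->]; rewrite wcatK; case: cid => b /= ->.
Qed.

Definition disjoint_cones p q := forall x, cone p x -> ~ cone q x.

Lemma disjoint_cones_sym p q : disjoint_cones p q -> disjoint_cones q p.
Proof. by move=> pq x qx px; exact: pq px qx. Qed.

Lemma disjoint_conesMr p q r s : disjoint_cones p q -> disjoint_cones (p * r) (q * s).
Proof. by move=> pq x /coneM[px _] /coneM[qx _]; exact: pq px qx. Qed.

Lemma disjoint_conesMl w p q : disjoint_cones p q -> disjoint_cones (w * p) (w * q).
Proof. by move=> pq x /coneM[_ px] /coneM[_ qx]; exact: pq px qx. Qed.

Lemma dV_eqP (f g : dV d n) : f =1 g <-> f = g.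
Proof. by split=> [fg|-> //]; apply: val_inj; exact: homeoP. Qed.

Section Swap.
Variables p q : word d n.
Hypothesis pq : disjoint_cones p q.

Definition swap_fun x : X :=
  if `[< cone p x >] then wcat q (wdrop p x)
  else if `[< cone q x >] then wcat p (wdrop q x) else x.

Lemma swap_funl y : swap_fun (wcat p y) = wcat q y.
Proof. by rewrite /swap_fun asboolT ?wcatK //; exact: wcat_cone. Qed.

Lemma swap_funr y : swap_fun (wcat q y) = wcat p y.
Proof.
rewrite /swap_fun asboolF; last by move/pq; apply; exact: wcat_cone.
by rewrite asboolT ?wcatK //; exact: wcat_cone.
Qed.

Lemma swap_fun_out x : ~ cone p x -> ~ cone q x -> swap_fun x = x.
Proof. by move=> px qx; rewrite /swap_fun !asboolF. Qed.

Lemma swap_funK : involutive swap_fun.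
Proof.
move=> x; have [/coneP[y ->]|px] := pselect (cone p x).
  by rewrite swap_funl swap_funr.
have [/coneP[y ->]|qx] := pselect (cone q x); first by rewrite swap_funr swap_funl.
by rewrite !swap_fun_out.
Qed.

Lemma swap_fun_locally_prefix : locally_prefix swap_fun.
Proof.
move=> x; have [k pk] := word_bound p; have [l ql] := word_bound q.
(* At this depth a cone lies inside the cone of [p], inside that of [q], or misses both. *)
pose m := maxn k l; exists m.
have in_cone w z : (forall i, size (w i) <= m) -> cone w (wcat (trunc m x) z) ->
    exists r, trunc m x = w * r.
  move=> wm wz; exists (word_sub (trunc m x) w); rewrite word_subK // => i.
  by apply: iprefix_total (wz i) (wcat_cone _ _ i) _; rewrite size_itake wm.
have pm i : size (p i) <= m by rewrite (leq_trans (pk i)) // leq_maxl.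
have qm i : size (q i) <= m by rewrite (leq_trans (ql i)) // leq_maxr.
have [[r ->]|pN] := pselect (exists r, trunc m x = p * r).
  by exists (q * r) => z; rewrite wcatM swap_funl wcatM.
have [[r ->]|qN] := pselect (exists r, trunc m x = q * r).
  by exists (p * r) => z; rewrite wcatM swap_funr wcatM.
exists (trunc m x) => z.
by rewrite swap_fun_out // => /in_cone; [move/(_ pm)/pN|move/(_ qm)/qN].
Qed.

Definition swap_homeo : homeo X :=
  @Homeo _ swap_fun swap_fun swap_funK swap_funK
    (locally_prefix_continuous swap_fun_locally_prefix)
    (locally_prefix_continuous swap_fun_locally_prefix).

Fact swap_dV : swap_homeo \in @dV_pred d n.
Proof. by apply/dV_locally_prefix; exact: swap_fun_locally_prefix. Qed.

Definition swap : dV d n := DV swap_dV.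

Lemma swapl y : swap (wcat p y) = wcat q y. Proof. exact: swap_funl. Qed.

Lemma swap_out x : ~ cone p x -> ~ cone q x -> swap x = x.
Proof. exact: swap_fun_out. Qed.

Lemma swap_sq : swap * swap = 1.
Proof. by apply/dV_eqP => x; exact: swap_funK. Qed.

End Swap.

End PrefixMaps.

(** * A group-theoretic substitute for disjointness of supports *)

Section AlgebraicDisjointness.
Variable G : groupType.
Implicit Types f g h : G.

(** Rubin's relation of algebraic disjointness. Being phrased in the group language, it is preserved
    by automorphisms. In V it follows from disjointness of supports and implies that [f] and
    [g ^+ 12] have disjoint supports. *)
Definition algebraically_disjoint f g := forall h, ~ commute f h ->
  exists f1 f2, [/\ commute g f1, commute g f2,
    commute g [~ f1, [~ f2, h]] & [~ f1, [~ f2, h]] <> 1].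

Lemma aut1 (a : aut G) : a 1 = 1.
Proof. by apply: (@mulgI _ (a 1)); rewrite -gmulfM !mulg1. Qed.

Lemma autV (a : aut G) f : a f^-1 = (a f)^-1.
Proof. by apply: (@mulgI _ (a f)); rewrite -gmulfM !mulgV aut1. Qed.

Lemma autR (a : aut G) f g : a [~ f, g] = [~ a f, a g].
Proof. by rewrite !gmulfM !autV. Qed.

Lemma autX (a : aut G) f k : a (f ^+ k) = a f ^+ k.
Proof. by elim: k => [|k IHk]; rewrite ?expg0 ?aut1 // !expgS gmulfM IHk. Qed.

Lemma autK (a : aut G) : cancel a (a^-1)%g.
Proof. by move=> f; have := congr1 (fun b : aut G => b f) (mulgV a). Qed.

Lemma autVK (a : aut G) : cancel (a^-1)%g a.
Proof. by move=> f; have := congr1 (fun b : aut G => b f) (mulVg a). Qed.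

Lemma aut_algebraically_disjoint (a : aut G) f g :
  algebraically_disjoint f g -> algebraically_disjoint (a f) (a g).
Proof.
move=> fg h fh; have {}fh : ~ commute f (a^-1 h).
  by move=> /(gmulf_commute (aut_fun a)); rewrite autVK.
have [f1 [f2 [gf1 gf2 gc c1]]] := fg _ fh; exists (a f1), (a f2).
have -> : [~ a f1, [~ a f2, h]] = a [~ f1, [~ f2, a^-1 h]] by rewrite !autR autVK.
split; try exact: gmulf_commute.
by move=> /(congr1 (a^-1)%g); rewrite autK aut1.
Qed.

End AlgebraicDisjointness.

(** * Supports in V and their relation to algebraic disjointness *)

Section Supports.
Variables d n : nat.
Hypotheses (hd : 0 < d) (hn : 1 < n).
Local Notation X := (cantor_power d n).
Implicit Types (p q w : word d n) (x y z : X) (f g h k : dV d n) (U : set X).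

Lemma dVK f : cancel f (f^-1)%g.
Proof. exact: homeoK. Qed.

Lemma dVVK f : cancel (f^-1)%g f.
Proof. exact: homeo_invK. Qed.

Lemma dV_inj f : injective f.
Proof. exact: can_inj (dVK f). Qed.

Lemma dV_commuteP f g : commute f g <-> forall x, f (g x) = g (f x).
Proof.
split=> [fg x|fg]; first by have := congr1 (fun h : dV d n => h x) fg.
by apply/dV_eqP => x; rewrite /= fg.
Qed.

Definition supported_on f U := forall x, ~ U x -> f x = x.

Lemma supported_onV f U : supported_on f U -> supported_on (f^-1)%g U.
Proof. by move=> fU x /fU{1}<-; rewrite dVK. Qed.

Lemma supported_in f U x : supported_on f U -> U x -> U (f x).
Proof.
move=> fU Ux; apply: contrapT => h; have := fU _ h.
by move/dV_inj => e; apply: h; rewrite e.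
Qed.

Definition at_coord (i : 'I_d) (s : seq 'I_n) : word d n :=
  fun j => if j == i then s else [::].

Lemma disjoint_letters i (a b : 'I_n) : a <> b ->
  disjoint_cones (at_coord i [:: a]) (at_coord i [:: b]).
Proof.
move=> ab x /(_ i) + /(_ i); rewrite /at_coord eqxx => -[xa] [xb].
by apply: ab; rewrite -xa -xb.
Qed.

Lemma other_letter (a : 'I_n) : exists b : 'I_n, a <> b.
Proof.
have [->|/eqP h] := eqVneq a (Ordinal hn); last by exists (Ordinal hn).
by exists (Ordinal (ltnW hn)).
Qed.

Lemma swap_supported w p q (wpq : disjoint_cones (w * p) (w * q)) :
  supported_on (swap wpq) (cone w).
Proof. by move=> x wx; apply: swap_out => /coneM[]. Qed.

(** Swap the two subcones of [w] given by the letter of [x] after [w] in one coordinate and by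
    another letter. *)
Lemma dV_moving_involution w x : cone w x ->
  exists f, [/\ f * f = 1, supported_on f (cone w) & f x <> x].
Proof.
pose i := Ordinal hd => /coneP[y ->].
have [a ya] : exists a, cone (at_coord i [:: a]) y.
  by exists (y i 0) => j; rewrite /at_coord; case: eqP => [->|].
have [b ab] := other_letter a.
have D := disjoint_conesMl (w := w) (disjoint_letters (i := i) ab).
exists (swap D); split; [exact: swap_sq|exact: swap_supported|].
rewrite -(wdropK ya) -wcatM swapl => e.
apply: D (wcat_cone _ (wdrop (at_coord i [:: a]) y)) _.
by rewrite -e; exact: wcat_cone.
Qed.

(* For two letters 0 and 1 in a fixed coordinate, f exchanges w0 and w1, and  *)
(* g exchanges w1 and w00, so that f * g maps w0 onto w00.                    *)
Lemma dV_local_pair w : exists f g, [/\ supported_on f (cone w),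
  supported_on g (cone w), ~ commute f g & forall m, (f * g) ^+ m.+1 <> 1].
Proof.
pose i := Ordinal hd; pose c : X := fun _ _ => Ordinal hn.
have [b ab] := other_letter (Ordinal hn).
pose e0 := at_coord i [:: Ordinal hn]; pose e1 := at_coord i [:: b].
have e01 : disjoint_cones e0 e1 by exact: disjoint_letters.
have D1 := disjoint_conesMl (w := w) e01.
have e10 : disjoint_cones e1 (e0 * e0).
  by rewrite -(mulg1 e1); apply/disjoint_conesMr/disjoint_cones_sym.
have D2 := disjoint_conesMl (w := w) e10.
have fg y : (swap D1 * swap D2) (wcat (w * e0) y) = wcat (w * e0) (wcat e0 y).
  by rewrite [LHS](_ : _ = swap D2 (swap D1 (wcat (w * e0) y))) // !swapl -!wcatM !mulgA.
exists (swap D1), (swap D2); split; try exact: swap_supported.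
  have x2 : swap D2 (wcat (w * e0) (wcat e1 c)) = wcat (w * e0) (wcat e1 c).
    apply: swap_out => [|h].
      exact: D1 (wcat_cone _ _).
    apply: (e01 (wcat e1 c)); last exact: wcat_cone.
    by apply/(coneM_wcat (w * e0)); rewrite -mulgA.
  move=> /dV_commuteP/(_ (wcat (w * e0) (wcat e1 c))).
  rewrite x2 !swapl => e.
  apply: (D1 (wcat (w * e1) (wcat e1 c))); last exact: wcat_cone.
  by rewrite e mulgA wcatM; exact: wcat_cone.
move=> l /(congr1 (fun f => f (wcat (w * e0) (wcat e1 c)))).
have -> m y : ((swap D1 * swap D2) ^+ m) (wcat (w * e0) y) =
    wcat (w * e0) (iter m (wcat e0) y).
  elim: m y => [|m IHm] y; first by rewrite expg0.
  by rewrite expgS iterSr -IHm -fg.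
move=> /wcatI e; apply: (e01 (wcat e1 c)); last exact: wcat_cone.
by rewrite -e; exact: wcat_cone.
Qed.

Lemma dV_commute_supported f g U : supported_on f U -> (forall x, U x -> g x = x) ->
  commute g f.
Proof.
move=> fU gU; apply/dV_commuteP => x; have [Ux|Ux] := pselect (U x).
  by rewrite (gU x) // gU //; exact: supported_in fU Ux.
rewrite (fU x) // fU // => Ugx; apply: Ux.
by have /dV_inj <- := gU _ Ugx.
Qed.

Definition displaces (f : X -> X) m x :=
  forall z, cone (trunc m x) z -> ~ cone (trunc m x) (f z).

Lemma homeo_displaces (f : homeo X) x : f x <> x ->
  exists m, forall m', m <= m' -> displaces f m' x.
Proof.
move=> fx; have [i [j fxij]] : exists i j, f x i j <> x i j.
  apply: contrapT => h; apply: fx; apply: funext => i; apply: funext => j.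
  by apply: contrapT => hij; apply: h; exists i, j.
have [m hm] := homeo_cone f x j.+1.
exists (maxn m j.+1) => m'; rewrite geq_max => /andP[mm' jm'] z xz xfz.
apply: fxij; have := hm _ (cone_trunc_le mm' xz).
by move=> /cone_truncP/(_ i j (ltnSn j)) <-; move/cone_truncP: xfz; apply.
Qed.

(** Take a cone [U] that [f] and [h] both move off itself, so that [g] is trivial on it, and two
    non-commuting elements [a], [b] supported on [U]. On [U] the commutator of [b] and [h] acts as
    [b^-1], so its commutator with [a] is that of [a] and [b^-1], which is nontrivial and commutes
    with [g]. *)
Lemma disjoint_supports_algebraically_disjoint f g :
  (forall x, f x = x \/ g x = x) -> algebraically_disjoint f g.
Proof.
(* If [f] and [h] fail to commute at [x], then one of [x], [h x], [f x] is moved by both. *)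
move=> fg h fh; have [x [fx hx]] : exists x, f x <> x /\ h x <> x.
  have [x fhx] : exists x, f (h x) <> h (f x).
    apply: contrapT => e; apply: fh; apply/dV_commuteP => x.
    by apply: contrapT => ex; apply: e; exists x.
  have [fx|fx] := pselect (f x = x).
    exists (h x); split; first by move=> e; apply: fhx; rewrite fx.
    by move/dV_inj => e; apply: fhx; rewrite e fx.
  have [hx|hx] := pselect (h x = x); last by exists x.
  exists (f x); split; last by move=> e; apply: fhx; rewrite hx.
  by move/dV_inj.
have [m1 /(_ _ (leq_maxl m1 _)) fm] := homeo_displaces fx.
have [m2 /(_ _ (leq_maxr _ m2)) hm] := homeo_displaces hx.
pose U := cone (trunc (maxn m1 m2) x).
have fU z : U z -> ~ U (f z) by exact: fm.
have hU z : U z -> ~ U (h z) by exact: hm.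
have gU z : U z -> g z = z by move=> Uz; case: (fg z) => // e; case: (fU _ Uz); rewrite e.
have [a [b [aU bU ab _]]] := dV_local_pair (trunc (maxn m1 m2) x).
have ga := dV_commute_supported aU gU; have gb := dV_commute_supported bU gU.
have aVU := supported_onV aU; have bVU := supported_onV bU.
pose H := [~ b, h]; have HE z : H z = h (b (h^-1 (b^-1 z))) by [].
have HU z : U z -> H z = b^-1 z.
  move=> Uz; rewrite HE bU ?dVVK // => Uy.
  by apply: (hU _ Uy); rewrite dVVK; exact: supported_in bVU Uz.
have HVU z : U z -> H^-1 z = b z.
  move=> Uz; apply: (@dV_inj H); rewrite dVVK HU ?dVK //; exact: supported_in bU Uz.
have eqc : [~ a, H] = [~ a, b^-1].
  apply/dV_eqP => z; rewrite [LHS](_ : _ = H (a (H^-1 (a^-1 z)))) //.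
  rewrite [RHS](_ : _ = b^-1 (a (b (a^-1 z)))); last by rewrite /commg /conjg invgK.
  have [Uz|Uz] := pselect (U z).
    have Uaz := supported_in aVU Uz; rewrite HVU // HU //.
    exact/(supported_in aU)/(supported_in bU).
  rewrite aVU // (bU z) // (aU z) // bVU // aU ?dVVK // => UHz.
  by apply: Uz; rewrite -(dVVK H z) HU //; exact: supported_in bVU UHz.
exists a, b; rewrite -/H eqc; split=> //.
  rewrite /commg /conjg invgK.
  by do 3?apply: commuteM => //; apply: commuteV.
by move/eqP/commgP => /commuteV; rewrite invgK.
Qed.

Lemma dV_fixX f x m : f x = x -> (f ^+ m) x = x.
Proof.
move=> fx; elim: m => [|m IHm]; first by rewrite expg0.
by rewrite expgSr [LHS](_ : _ = f ((f ^+ m) x)) // IHm.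
Qed.

(* 12 is divisible by 1, 2, 3 and 4, so a point moved by g ^+ 12 has at least *)
(* five images under the powers of g, while the double commutator is supported *)
(* on four translates of a small cone.                                        *)
Lemma algebraically_disjoint_support f g : algebraically_disjoint f g ->
  forall x, f x = x \/ (g ^+ 12) x = x.
Proof.
move=> fg x; apply: contrapT => /not_orP[fx gx].
have gjx j : 0 < j < 5 -> (g ^+ j) x <> x.
  move=> j5 gjx; apply: gx.
  have /dvdnP[k ->] : j %| 12 by case: j j5 {gjx} => [|[|[|[|[|]]]]].
  by rewrite mulnC expgnA; exact: dV_fixX.
have [m [fm gm]] : exists m, displaces f m x /\
    forall j, 0 < j < 5 -> displaces (g ^+ j) m x.
  have [m0 hm0] := homeo_displaces fx.
  have mj (j : 'I_5) : exists m, forall m', m <= m' -> 0 < j -> displaces (g ^+ j) m' x.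
    case: (posnP j) => [->|j0]; first by exists 0.
    have /homeo_displaces[m hm] : (g ^+ j) x <> x by apply: gjx; rewrite j0 ltn_ord.
    by exists m => m' /hm.
  pose M j := sval (cid (mj j)); exists (maxn m0 (\max_j M j)); split.
    by apply: hm0; exact: leq_maxl.
  move=> j /andP[j0 j5]; apply: (svalP (cid (mj (Ordinal j5)))) => //.
  by rewrite leq_max; apply/orP; right; exact: leq_bigmax.
pose U := cone (trunc m x).
have [h [_ hU hx]] := dV_moving_involution (trunc_cone m x).
have fh : ~ commute f h.
  move=> /dV_commuteP/(_ x); rewrite (hU (f x)) => [/dV_inj//|].
  exact: fm (trunc_cone m x).
have [f1 [f2 [gf1 gf2 gc c1]]] := fg _ fh.
pose H := [~ f2, h]; pose c := [~ f1, H].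
have HU z : H z <> z -> U z \/ U (f2^-1 z).
  move=> Hz; apply: contrapT => /not_orP[Uz Ufz]; apply: Hz.
  by rewrite [LHS](_ : _ = h (f2 (h^-1 (f2^-1 z)))) // (supported_onV hU) // dVVK hU.
pose T := [:: 1; f2^-1; f1^-1; f1^-1 * f2^-1].
have cU z : c z <> z -> exists i : 'I_4, U (nth 1 T i z).
  move=> cz; have [Hz|Hz] := pselect (H z = z); last first.
    by case: (HU _ Hz) => ?; [exists ord0|exists (inord 1); rewrite inordK].
  have [|/HU[]] := pselect (H (f1^-1 z) = f1^-1 z); last 2 first.
  - by exists (inord 2); rewrite inordK.
  - by exists (inord 3); rewrite inordK.
  move=> Hfz; case: cz; rewrite [LHS](_ : _ = H (f1 (H^-1 (f1^-1 z)))) //.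
  by rewrite -{1}Hfz dVK dVVK.
have gT i : commute g (nth 1 T i).
  case: i => [|[|[|[|i]]]] /=; rewrite ?nth_nil.
  all: try exact: commute1.
  all: try exact: commuteV.
  by apply: commuteM; exact: commuteV.
have [z cz] : exists z, c z <> z.
  apply: contrapT => e; apply: c1; apply/dV_eqP => z.
  by apply: contrapT => cz; apply: e; exists z.
(* As [c] commutes with [g], the five points [(g ^+ j) z] are all moved by [c]. By pigeonhole some
   [t] in [T] takes two of them into [U]; since [t] commutes with [g], a power of [g] with exponent
   from 1 to 4 would then take a point of [U] into [U]. *)
have czj (j : 'I_5) : exists i : 'I_4, U (nth 1 T i ((g ^+ j) z)).
  apply: cU; have /commute_sym/(commuteX j)/dV_commuteP -> := gc.
  by move/dV_inj.
pose psi j := sval (cid (czj j)).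
have /injectivePn[j [k jk ejk]] : ~~ injectiveb psi.
  by apply/injectiveP => /leq_card; rewrite !card_ord.
wlog ltjk : j k jk ejk / j < k.
  move=> wl; case: (ltngtP j k) => [|kj|/val_inj e]; first exact: wl.
    by apply: (wl k j) => //; rewrite eq_sym.
  by rewrite e eqxx in jk.
have := svalP (cid (czj k)); rewrite -/(psi k) -ejk.
have := svalP (cid (czj j)); rewrite -/(psi j).
set t := nth 1 T (psi j) => Uj.
have -> : (g ^+ k) z = (g ^+ (k - j)) ((g ^+ j) z).
  by rewrite -{1}(subnKC (ltnW ltjk)) expgnDr.
have /commute_sym/(commuteX (k - j))/dV_commuteP -> := gT (psi j).
by apply: (gm _ _) Uj; rewrite subn_gt0 ltjk (leq_ltn_trans (leq_subr _ _)).
Qed.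

End Supports.

(** * The homeomorphism inducing a given automorphism of V *)

Section Reconstruction.
Variables d n : nat.
Hypotheses (hd : 0 < d) (hn : 1 < n).
Local Notation X := (cantor_power d n).
Implicit Types (b w : word d n) (x y z u : X) (f g : dV d n) (a : aut (dV d n)).

Definition trivial_near f x := exists m, forall z, cone (trunc m x) z -> f z = z.

Lemma wcat_shift w x i j : wcat w x i (size (w i) + j) = x i j.
Proof. by have := congr1 (fun u : cantor n => u j) (icatK (w i) (x i)). Qed.

(* If f is s u |-> b u near its fixed point y, then f * f = 1 forces every x  *)
(* near y to be invariant under a shift by 2 (size (b i) - size (s i)) in each *)
(* coordinate i.                                                              *)
Lemma involution_trivial_near f y : f * f = 1 -> f y = y -> trivial_near f y.
Proof.
move=> ff fy; have ffK x : f (f x) = x by have := congr1 (fun g : dV d n => g x) ff.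
have /dV_locally_prefix/(_ y)[m [b fb]] := dV_valP f.
have [u yu] := (coneP _ _).1 (trunc_cone m y).
have bu : wcat b u = y by rewrite -fb -yu.
have shift x i j : cone (trunc m y) x -> f x i (size (b i) + j) = x i (m + j).
  move=> /coneP[x' ->]; rewrite fb wcat_shift.
  by have := wcat_shift (trunc m y) x' i j; rewrite [X in X + _]size_itake => ->.
suff sb i : size (b i) = m.
  exists m => z /coneP[z' ->]; rewrite fb; congr wcat; apply: funext => i.
  by rewrite -[LHS](icat_prefix (b i) (u i)) sb /trunc -bu.
apply: contrapT => bm.
have [k hk] := homeo_cone f y m; rewrite fy in hk.
(* These satisfy [size (b i) + j = m + j'], so two applications of [shift] meet at the same letter
   of [f x]. They equate the letters of [x] at [size (b i) + j'] and [m + j]; the latter position is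
   at least [M], so changing that letter of [y] stays in the cone and breaks the equality. *)
pose M := maxn k m; pose j := M + m; pose j' := size (b i) + M.
have period x : cone (trunc M y) x -> x i (size (b i) + j') = x i (m + j).
  move=> xy; have xm := cone_trunc_le (leq_maxr k m) xy.
  have fxm := hk _ (cone_trunc_le (leq_maxl k m) xy).
  rewrite -(shift x i j) // -{1}(ffK x) (shift (f x)) //.
  by congr (f x i _); rewrite /j /j' addnCA (addnC m).
have neq : size (b i) + j' != m + j.
  apply/eqP; rewrite /j /j' => e; apply: bm.
  by apply/double_inj; apply/(@addIn M); rewrite -!addnn -!addnA e (addnC m M).
have [l yl] := other_letter hn (y i (m + j)).
pose x : X := fun i' k' => if k' == m + j then l else y i' k'.
have xy : cone (trunc M y) x.
  apply/cone_truncP => i' k' kM; rewrite /x; case: eqP => // e.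
  by move: kM; rewrite e /j addnCA ltnNge leq_addr.
have := period _ xy; rewrite /x (negPf neq) eqxx (period y) //.
exact: trunc_cone.
Qed.

Lemma separating_involution x x' : x <> x' ->
  exists f, [/\ f * f = 1, trivial_near f x & f x' <> x'].
Proof.
move=> xx'; have [m xm] : exists m, ~ cone (trunc m x') x.
  apply: contrapT => h; apply: xx'; apply: funext => i; apply: funext => j.
  apply: contrapT => xij; apply: h; exists j.+1 => /cone_truncP/(_ i j (ltnSn j)).
  exact: xij.
have [f [ff fx' fm]] := dV_moving_involution hd hn (trunc_cone m x').
exists f; split=> //; exists m => z xz; apply: fx' => x'z; apply: xm.
rewrite -(cone_trunc_eq x'z) (cone_trunc_eq xz); exact: trunc_cone.
Qed.

(** Let [p * q] have infinite order and support in the cone of [w]. Every such [f] has support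
    disjoint from that of [p * q], so [a f] fixes each point moved by [a (p * q) ^+ 12], and this
    power is nontrivial. *)
Lemma aut_common_fixed_point a w :
  exists y, forall f, (forall z, cone w z -> f z = z) -> a f y = y.
Proof.
have [p [q [pw qw _ pq]]] := dV_local_pair hd hn w.
have pqw : supported_on (p * q) (cone w).
  by move=> x wx; rewrite [LHS](_ : _ = q (p x)) // pw // qw.
have [y ay] : exists y, (a (p * q) ^+ 12) y <> y.
  apply: contrapT => h; apply: (pq 11).
  rewrite -(autK a ((p * q) ^+ 12)) -(aut1 (a^-1)).
  congr (a^-1 _); rewrite autX; apply/dV_eqP => y.
  by apply: contrapT => ay; apply: h; exists y.
exists y => f fw.
have D : algebraically_disjoint f (p * q).
  apply: disjoint_supports_algebraically_disjoint => // x.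
  by have [/fw|/pqw] := pselect (cone w x); [left|right].
have := algebraically_disjoint_support hd hn (aut_algebraically_disjoint (a := a) D) y.
by case.
Qed.

(** If [a] is conjugation by a homeomorphism, its graph satisfies this relation. For every [a] the
    relation turns out to be the graph of a bijection. *)
Definition corresponds a x y := forall f, trivial_near f x -> a f y = y.

(** The common fixed points for smaller and smaller cones around [x] cluster at some [y] by
    compactness. An [a f] moving [y] would move all points near [y], including some of these fixed
    points. *)
Lemma corresponds_exists a x : exists y, corresponds a x y.
Proof.
pose Z m := [set y | forall f, (forall z, cone (trunc m x) z -> f z = z) -> a f y = y].
have FF : ProperFilter (filter_from setT Z).
  apply: filter_from_proper; last first.
    by move=> m _; have [y] := aut_common_fixed_point a (trunc m x); exists y.
  apply: filter_from_filter; first by exists 0.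
  move=> k m _ _; exists (maxn k m) => // y Zy; split=> f fx; apply: Zy => z xz;
    by apply: fx; apply: cone_trunc_le xz; rewrite ?leq_maxl ?leq_maxr.
have [|y [_ cy]] := @cantor_power_compact d n _ FF; first by exists 0.
exists y => f [m fm]; apply: contrapT => /homeo_displaces[k /(_ _ (leqnn k)) fk].
have [z [Zz yz]] : Z m `&` cone (trunc k y) !=set0.
  by apply: cy; [exists m|exact: cone_nbhs (trunc_cone _ _)].
by have := fk z yz; rewrite (_ : a f z = z) //; exact: Zz f fm.
Qed.

(** Let [x'] correspond to [y] under [a^-1]. If it differed from [x], some involution [f] trivial
    near [x] would move it; but [a f] is an involution fixing [y], hence trivial near [y], which
    forces [f] to fix [x']. *)
Lemma corresponds_sym a x y : corresponds a x y -> corresponds a^-1 y x.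
Proof.
move=> axy; have [x' ayx'] := corresponds_exists a^-1 y.
have [-> //|/separating_involution[f [ff fx fx']]] := pselect (x = x').
case: fx'; rewrite -{2}(ayx' (a f)) ?autK //.
by apply: involution_trivial_near; [rewrite -gmulfM ff aut1|exact: axy].
Qed.

Lemma corresponds_uniq a x y y' : corresponds a x y -> corresponds a x y' -> y = y'.
Proof.
move=> axy axy'; apply: contrapT => /separating_involution[f [ff fy fy']].
apply: fy'; rewrite -{1}(autVK a f); apply: axy'.
apply: involution_trivial_near; first by rewrite -gmulfM ff aut1.
exact: (corresponds_sym axy).
Qed.

Definition aut_point a x : X := sval (cid (corresponds_exists a x)).

Lemma aut_pointP a x : corresponds a x (aut_point a x).
Proof. exact: svalP (cid _). Qed.

Lemma aut_pointK a : cancel (aut_point a) (aut_point a^-1).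
Proof.
move=> x; apply: (@corresponds_uniq (a^-1) (aut_point a x)); first exact: aut_pointP.
exact: corresponds_sym (@aut_pointP a x).
Qed.

Lemma aut_pointVK a : cancel (aut_point a^-1) (aut_point a).
Proof. by move=> x; rewrite -{1}(invgK a) aut_pointK. Qed.

Lemma aut_point_equivariant a f x : aut_point a (f x) = a f (aut_point a x).
Proof.
apply: (@corresponds_uniq a (f x)); first exact: aut_pointP.
move=> g [m gm].
have [k hk] := homeo_cone f x m.
have : trivial_near (g ^ f^-1) x.
  exists k => z /hk/gm gfz; apply: (@dV_inj _ _ f).
  by rewrite /conjg invgK [LHS](_ : _ = f (f^-1 (g (f z)))) // dVVK gfz.
move=> /(@aut_pointP a _); rewrite /conjg invgK !gmulfM autV => e.
by rewrite -[in RHS]e [RHS](dVVK (a f)).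
Qed.

(** By equivariance [aut_point a] matches the points moved by [a^-1 f] with those moved by [f].
    Choose [f] supported near the image of [x] and moving it; then [a^-1 f] moves every point near
    [x]. *)
Lemma aut_point_continuous a : continuous (aut_point a).
Proof.
move=> x A /nbhs_coneP[m xA].
have [f [_ fm fx]] := dV_moving_involution hd hn (trunc_cone m (aut_point a x)).
pose g := a^-1 f.
have gE z : g z <> z <-> f (aut_point a z) <> aut_point a z.
  rewrite -{1}(autVK a f) -/g -aut_point_equivariant; split=> gz e; apply: gz.
    exact: can_inj (aut_pointK a) _ _ e.
  by rewrite e.
have /homeo_displaces[k /(_ _ (leqnn k)) gk] : g x <> x by apply/gE.
apply/nbhs_coneP; exists k => z xz; apply: xA; apply: contrapT => /fm fz.
by have [h _] := gE z; apply: h fz => e; apply: gk (xz) _; rewrite e.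
Qed.

Definition aut_homeo a : homeo X :=
  @Homeo _ (aut_point a) (aut_point a^-1) (@aut_pointK a) (@aut_pointVK a)
    (@aut_point_continuous a) (@aut_point_continuous a^-1).

Lemma aut_homeoJ a f : dV_val (a f) = dV_val f ^ aut_homeo a.
Proof.
apply: homeoP => y; rewrite /conjg /= aut_point_equivariant.
by rewrite aut_pointVK.
Qed.

(** Otherwise some [f] trivial near [x] moves the preimage of [h' x] under [h]; then [f ^ h'] fixes
    [h' x] while [f ^ h] moves it. *)
Lemma dV_centralizer_homeo (h h' : homeo X) :
  (forall f, dV_val f ^ h = dV_val f ^ h') -> h = h'.
Proof.
move=> hh'; apply: homeoP => x; apply: contrapT => hx.
pose y := homeo_inv h (h' x).
have [|f [_ [m fx] fy]] := @separating_involution x y.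
  by move=> e; apply: hx; rewrite {1}e homeo_invK.
have := congr1 (fun g : homeo X => g (h' x)) (hh' f); rewrite /conjg /= homeoK.
rewrite (fx x (trunc_cone _ _)) -/y => e; apply: fy.
by rewrite -[LHS](homeoK h) e.
Qed.

End Reconstruction.

(** * Synchronizing homeomorphisms are those that conjugate V into itself *)

Section Normalizer.
Variables d n : nat.
Hypotheses (hd : 0 < d) (hn : 1 < n).
Local Notation X := (cantor_power d n).
Implicit Types (p q r s w : word d n) (x y z : X) (f : dV d n) (h : homeo X).

(** Near the preimage of [x], [f] replaces a prefix by [b]. After a further word [r] of length [k]
    both prefixes lead to equivalent states, so [h] acts alike behind them and the conjugate only
    exchanges their two output words. *)
Lemma dS_normalizes_dV h f : h \in @dS_pred d n -> dV_val f ^ h \in @dV_pred d n.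
Proof.
move=> /dSP[k hk]; apply/dV_locally_prefix => x; pose x' := homeo_inv h x.
have /dV_locally_prefix/(_ x')[m [b fb]] := dV_valP f.
have [r [er sr]] := trunc_subword x' (leq_addr k m).
have eqL : local_map h (trunc m x' * r) = local_map h (b * r).
  by apply/state_equivP => //; apply: hk => i; rewrite sr addKn.
have [k' hk'] := homeo_cone h^-1 x (m + k).
have [l hl] := word_bound (lcp_word h (trunc m x' * r)).
pose M := maxn k' l.
have pt : word_prefix (lcp_word h (trunc m x' * r)) (trunc M x).
  have sx i : iprefix (lcp_word h (trunc m x' * r) i) (x i).
    by have := lcp_word_prefix h (trunc_cone (m + k) x') i; rewrite homeo_invK er.
  by move=> i; rewrite -(sx i); apply: prefix_itake; apply: leq_trans (leq_maxr _ _).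
pose t := word_sub (trunc M x) (lcp_word h (trunc m x' * r)).
have tE : trunc M x = lcp_word h (trunc m x' * r) * t by rewrite word_subK.
exists M, (lcp_word h (b * r) * t) => z.
set y := wcat (trunc M x) z.
have /coneP[z' hy] : cone (trunc m x' * r) (homeo_inv h y).
  rewrite -er; apply: hk'; apply: cone_trunc_le (wcat_cone _ z); exact: leq_maxl.
have yE : y = wcat (lcp_word h (trunc m x' * r)) (local_map h (trunc m x' * r) z').
  by rewrite -local_mapE -hy homeo_invK.
rewrite [LHS](_ : _ = h (f (homeo_inv h y))) // hy wcatM fb -wcatM local_mapE -eqL.
rewrite wcatM; congr wcat; apply: (@wcatI _ _ (lcp_word h (trunc m x' * r))).
by rewrite -yE /y tE wcatM.
Qed.

Lemma word_ind (P : word d n -> Prop) : P 1 ->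
  (forall i a p, P p -> P (at_coord i [:: a] * p)) -> forall p, P p.
Proof.
move=> P1 PM p; have [N] := ubnP (\sum_i size (p i)).
elim: N p => // N IHN p; rewrite ltnS => pN.
have [[i pi]|p1] := pselect (exists i, p i != [::]); last first.
  rewrite (_ : p = 1) //; apply: funext => i; apply/eqP/negPn/negP => pi.
  by apply: p1; exists i.
case epi : (p i) pi => [//|a s] _.
pose p' : word d n := fun j => if j == i then s else p j.
have -> : p = at_coord i [:: a] * p'.
  apply: funext => j; rewrite wordM /at_coord /p'.
  by case: eqP => // ->.
apply/PM/IHN; apply: leq_trans pN.
rewrite (bigD1 i) //= [X in _ < X](bigD1 i) //= /p' eqxx epi /= ltnS.
by rewrite leq_add2l; apply/eq_leq/eq_bigr => j /negPf ->.
Qed.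

Lemma homeo_cone_trunc h m : exists k, forall w, (forall i, k <= size (w i)) ->
  forall y z, cone w y -> cone w z -> cone (trunc m (h y)) (h z).
Proof.
have [k hk] := homeo_uniform h m; exists k => w kw y z wy wz; apply: hk => i.
by apply: iprefixW (wz i); rewrite -(wy i); exact: prefix_itake.
Qed.

(** * Homeomorphisms conjugating V into itself are synchronizing *)

Section Synchronization.
Variable h : homeo X.
Hypothesis hV : forall f, dV_val f ^ h \in @dV_pred d n.

(** The conjugated swap takes the image of [p * w] followed by [z] to the image of [q * w] followed
    by [z]. For long [w] the images of the first kind share a prefix long enough for the conjugate
    to act by one replacement on them, so both states have the same local map. *)
Lemma normalizer_state_equiv p q : disjoint_cones p q ->
  exists k, forall w, (forall i, k <= size (w i)) -> state_equiv h (p * w) (q * w).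
Proof.
move=> pq; have /dV_locally_prefix/locally_prefix_uniform[m gm] := hV (swap pq).
have [k hk] := homeo_cone_trunc h m; exists k => w kw.
pose y : X := wcat (p * w) (fun _ _ => Ordinal hn).
have [b gb] := gm (h y).
pose phi z := wdrop (trunc m (h y)) (h (wcat (p * w) z)).
have hp z : h (wcat (p * w) z) = wcat (trunc m (h y)) (phi z).
  rewrite wdropK //; apply: (hk (p * w)); try exact: wcat_cone.
  by move=> i; rewrite wordM size_cat (leq_trans (kw i)) // leq_addl.
apply: (state_equiv_local (phi := phi) hn hp (u' := b)) => z.
rewrite -gb -hp [RHS](_ : _ = h (swap pq (homeo_inv h (h (wcat (p * w) z))))) //.
by rewrite homeoK !wcatM swapl.
Qed.

(** The two cones may be nested, so both are compared with a third word [r] disjoint from each. Its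
    letter [b] is doubled to cover the case [i = j], [a = b]. *)
Lemma normalizer_state_equiv_letters i j a c :
  exists k, forall w, (forall l, k <= size (w l)) ->
    state_equiv h (at_coord i [:: a] * (at_coord j [:: c] * w)) (at_coord j [:: c] * w).
Proof.
have [b cb] := other_letter hn c.
pose r := at_coord j [:: b] * at_coord j [:: b].
have D : disjoint_cones (at_coord j [:: c]) r.
  by rewrite /r -(mulg1 (at_coord j [:: c])); apply/disjoint_conesMr/disjoint_letters.
have D' : disjoint_cones (at_coord i [:: a] * at_coord j [:: c]) r.
  rewrite /r; have [<-|/eqP ij] := eqVneq i j.
    have [->|/eqP ab] := eqVneq a b; first exact/disjoint_conesMl/disjoint_letters.
    exact/disjoint_conesMr/disjoint_letters.
  have -> : at_coord i [:: a] * at_coord j [:: c] =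
      at_coord j [:: c] * at_coord i [:: a].
    by apply: funext => l; rewrite !wordM /at_coord; case: eqP => [->|]; case: eqP.
  exact/disjoint_conesMr/disjoint_letters.
have [k1 hk1] := normalizer_state_equiv D; have [k2 hk2] := normalizer_state_equiv D'.
exists (maxn k1 k2) => w kw t; rewrite mulgA hk2; last first.
  by move=> l; rewrite (leq_trans _ (kw l)) // leq_maxr.
by rewrite hk1 // => l; rewrite (leq_trans _ (kw l)) // leq_maxl.
Qed.

Lemma normalizer_dS : h \in @dS_pred d n.
Proof.
pose j := Ordinal hd.
pose K (t : 'I_d * 'I_n * 'I_n) :=
  sval (cid (normalizer_state_equiv_letters t.1.1 j t.1.2 t.2)).
pose k := \max_t K t.
have step i a w : (forall l, k < size (w l)) -> state_equiv h (at_coord i [:: a] * w) w.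
  move=> kw; case ew : (w j) (kw j) => [//|c s] _.
  have cw : word_prefix (at_coord j [:: c]) w.
    move=> l; rewrite /at_coord; case: eqP => [->|_]; rewrite ?prefix0s //.
    by rewrite ew /= eqxx prefix0s.
  rewrite -(word_subK cw).
  apply: (svalP (cid (normalizer_state_equiv_letters i j a c))) => l.
  rewrite /word_sub size_drop.
  apply: (@leq_trans k); first exact: (leq_bigmax (i, a, c)).
  have := kw l; rewrite /at_coord; case: eqP => _ /=; last by rewrite subn0 => /ltnW.
  by case: (size _) => // m; rewrite subn1.
have erase w : (forall l, k < size (w l)) -> forall p, state_equiv h (p * w) w.
  move=> kw; apply: word_ind => [|i a p IHp] t; first by rewrite mul1g.
  rewrite -mulgA step // => l.
  by rewrite wordM size_cat (leq_trans (kw l)) // leq_addl.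
(* The extra letter is the [c] that [step] splits off [w] in coordinate [j]. *)
by apply/dSP; exists k.+1 => p q w kw t; rewrite !erase.
Qed.

End Synchronization.

Lemma aut_homeo_dS (a : aut (dV d n)) : aut_homeo hd hn a \in @dS_pred d n.
Proof. by apply: normalizer_dS => f; rewrite -aut_homeoJ; exact: dV_valP. Qed.

Lemma aut_homeoV (a : aut (dV d n)) : aut_homeo hd hn a * aut_homeo hd hn a^-1 = 1.
Proof. by apply: homeoP => x; exact: aut_pointK. Qed.

Lemma aut_homeo_unit (a : aut (dV d n)) : exists v : dS d n,
  DS (aut_homeo_dS a) * v = 1 /\ v * DS (aut_homeo_dS a) = 1.
Proof.
exists (DS (aut_homeo_dS a^-1)); split; apply: val_inj; first exact: aut_homeoV.
by have := aut_homeoV a^-1; rewrite invgK.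
Qed.

Definition aut_dB (a : aut (dV d n)) : dB d n := MonoidUnit (aut_homeo_unit a).

Definition dB_homeo (u : dB d n) : homeo X := dS_val (unit_val u).

Lemma dB_homeo_inj : injective dB_homeo.
Proof. by move=> u v /val_inj/unit_val_inj. Qed.

Lemma aut_dBM : {morph aut_dB : a b / a * b}.
Proof.
move=> a b; apply: dB_homeo_inj; apply: (dV_centralizer_homeo hd hn) => f.
rewrite [RHS](_ : _ = dV_val f ^ (aut_homeo hd hn a * aut_homeo hd hn b)) //.
by rewrite conjgM -!aut_homeoJ.
Qed.

Definition dB_conj (u : dB d n) f : dV d n :=
  DV (dS_normalizes_dV f (dS_valP (unit_val u))).

Lemma dB_conjM u : {morph dB_conj u : f g / f * g}.
Proof. by move=> f g; apply: val_inj; exact: conjMg. Qed.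

Lemma dB_conjK (u v : dB d n) : u * v = 1 -> cancel (dB_conj u) (dB_conj v).
Proof.
move=> uv f; apply: val_inj.
rewrite [LHS](_ : _ = (dV_val f ^ dB_homeo u) ^ dB_homeo v) // -conjgM.
by rewrite [_ * _](_ : _ = dB_homeo (u * v)) // uv; exact: conjg1.
Qed.

(** Invertibility inside the monoid matters here: the inverse unit also conjugates V into itself, so
    conjugation by [u] is onto. *)
Definition dB_aut (u : dB d n) : aut (dV d n) :=
  Aut (aut_fun := HB.pack (dB_conj u) (isMultiplicative.Build _ _ _ (dB_conjM u)))
    (Bijective (dB_conjK (mulgV u)) (dB_conjK (mulVg u))).

Lemma aut_dBK : cancel aut_dB dB_aut.
Proof. by move=> a; apply: autP => f; apply: val_inj; rewrite /= aut_homeoJ. Qed.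

Lemma dB_autK : cancel dB_aut aut_dB.
Proof.
move=> u; apply: dB_homeo_inj; apply: (dV_centralizer_homeo hd hn) => f.
by rewrite [LHS](_ : _ = dV_val f ^ aut_homeo hd hn (dB_aut u)) // -aut_homeoJ.
Qed.

End Normalizer.

Theorem theorem4p14 (d n : nat) (hd : 1 <= d) (hn : 2 <= n) :
  exists Phi : {multiplicative aut (dV d n) -> dB d n}, bijective Phi.
Proof.
pose Phi : {multiplicative aut (dV d n) -> dB d n} :=
  HB.pack (aut_dB hd hn) (isMultiplicative.Build _ _ _ (aut_dBM hd hn)).
by exists Phi; exact: Bijective (aut_dBK hd hn) (dB_autK hd hn).
Qed.
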